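(* If $K\subset\mathbb R^2$ is a (closed) disk with positive radius, then for all $\lambda\ge0$, $K$ is the unique maximizer of $\Phi_\lambda^K(C)=\mathsf L(C)^3\mathsf A(C)^\lambda$ over all compact convex subsets $C$ of $K$.
   Context: For a compact convex set $C\subset\mathbb R^2$, $\mathsf A(C)$ is its area and $\mathsf L(C)=\int_{\partial C}\kappa(s)^{1/3}ds$ its affine perimeter, where $\kappa(s)\ge0$ is the curvature of $\partial C$ (existing almost everywhere) and $s$ is Euclidean arc length. *)

(* Defs.v *)
From HB Require Import structures.
From mathcomp Require Import all_boot all_order all_algebra.
From mathcomp Require Import all_classical all_reals all_analysis.

Set Implicit Arguments.
Unset Strict Implicit.
Unset Printing Implicit Defensive.

Import Order.TTheory GRing.Theory Num.Theory.
Import numFieldNormedType.Exports.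

Local Open Scope classical_set_scope.
Local Open Scope ring_scope.

Section plane.
Context {R : realType}.
Implicit Types (C K : set (R * R)) (gamma : R -> R * R) (s ell : R).

(* The library's norm on R * R is the max norm, hence this definition. *)
Definition euclidean_norm (p : R * R) : R := Num.sqrt (p.1 ^+ 2 + p.2 ^+ 2).

Definition disk (c : R * R) (r : R) : set (R * R) :=
  [set p | euclidean_norm (p - c) <= r].

Definition area C : \bar R := (@lebesgue_measure R \x @lebesgue_measure R)%E C.

Definition boundary C : set (R * R) := closure C `\` C°.

(* Length of the polygonal line inscribed in gamma with vertices at the
   parameters a :: t (the analogue of numfun.variation). *)
Definition polygonal_length (a b : R) gamma (t : seq R) : R :=
  let G := gamma \o nth b (a :: t) in
  \sum_(0 <= n < size t) euclidean_norm (G n.+1 - G n).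

Definition curve_length (a b : R) gamma : \bar R :=
  ereal_sup [set (polygonal_length a b gamma t)%:E | t in itv_partition a b].

(* gamma, restricted to [0, ell], is a parametrization by Euclidean arc length
   of the boundary of C, as a simple closed curve. The last condition implies
   that gamma is 1-Lipschitz on [0, ell]; corners are allowed. *)
Definition arc_length_param C ell gamma : Prop :=
  [/\ 0 < ell,
      gamma 0 = gamma ell,
      {in `[0, ell[ &, injective gamma},
      gamma @` `[0, ell] = boundary C &
      forall a b, 0 <= a -> a <= b -> b <= ell ->
        curve_length a b gamma = (b - a)%:E].

(* The right derivative of gamma. For gamma as above with C convex, it exists
   at every s in [0, ell[ and is a unit vector; it is the unit tangent vector
   at all but countably many s. Using the right derivative makes it defined at
   corners too, which may be dense in the boundary. *)
Definition unit_tangent gamma s : R * R :=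
  lim (h^-1 *: (gamma (s + h) - gamma s) @[h --> 0^'+]).

(* kappa(s) = |T'(s)|, where T is the unit tangent. For C convex, T has bounded
   variation on [0, ell[, so T'(s) exists for almost every s. *)
Definition curvature gamma s : R :=
  euclidean_norm (derive1 (unit_tangent gamma) s).

Definition param_affine_perimeter ell gamma : \bar R :=
  (\int[lebesgue_measure]_(s in `[0%R, ell]) (curvature gamma s `^ 3^-1)%:E)%E.

(* For C compact and convex with nonempty interior, arc-length parametrizations
   of the boundary exist and all yield the same integral, as they differ only
   by the starting point and the orientation. If C has empty interior (C empty,
   a point or a segment), no parametrization exists and the value is the
   default 0, the affine perimeter of a degenerate convex set. *)
Definition affine_perimeter C : \bar R :=
  xget 0%E [set L | exists ell gamma,
    arc_length_param C ell gamma /\ L = param_affine_perimeter ell gamma].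

(* Conventions of poweR: 0 `^ 0 = 1, and 0 `^ lambda = 0 for lambda != 0. *)
Definition Phi (lambda : R) C : \bar R :=
  (affine_perimeter C ^+ 3 * area C `^ lambda)%E.

Definition compact_convex_subset K C : Prop :=
  [/\ compact C, convex_set (M := (R * R)%type) C & C `<=` K].

Definition is_maximizer (f : set (R * R) -> \bar R)
    (F : set (set (R * R))) (M : set (R * R)) : Prop :=
  F M /\ (forall C, F C -> (f C <= f M)%E).

End plane.

(* Main.v *)
Require Import Defs.
From HB Require Import structures.
From mathcomp Require Import all_boot all_order all_algebra.
From mathcomp Require Import all_classical all_reals all_analysis.
From mathcomp Require Import measurable_realfun.
From mathcomp Require Import ring lra.

Import Order.TTheory GRing.Theory Num.Theory.
Import numFieldNormedType.Exports.

Local Open Scope classical_set_scope.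
Local Open Scope ring_scope.

(** The affine perimeter of a compact convex set [C] in a disk of radius [r] is
    bounded through two Euclidean quantities, the length [l] of the boundary and
    its total curvature. By the arithmetic-geometric inequality, the curvature
    [kappa] satisfies at each boundary point
      [kappa ^ (1/3) <= r ^ (-1/3) * (r * kappa + 2) / 3],
    with equality for [kappa = 1 / r]. The total curvature is at most [2 pi] and
    [l <= 2 pi r], with strict inequality unless [C] is the disk. So the affine
    perimeter of [C] is at most [2 pi r ^ (2/3)], its value on the disk,
    and it is smaller if [C] is not the disk. The area of [C] is at most that of
    the disk, which is positive and finite, and the product [Phi] inherits both
    conclusions. A set without parametrized boundary has affine perimeter [0].

    The two bounds have a common source. A line that has points of [C] strictly
    on both sides meets the boundary at most twice ([boundary_line]): the middle
    one of three points would be interior. Hence, for an arc length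
    parametrization [gamma] and any direction [u], the function [dot gamma u]
    rises once and falls once around the curve ([convex_two_turns]).

    - Length. The variation of [dot gamma u] is at most twice the width of [C] in
      the direction [u]. Averaged over [u], this bounds the length by Cauchy's
      formula ([perimeter_le]). A point of the disk outside [C] can be separated
      from [C], which makes the widths in some directions smaller than [2 r]
      ([perimeter_lt]).

    - Total curvature. Monotonicity in each direction also provides the curve
      with a right tangent [T] at each point, which is a unit vector
      ([right_tangent]), and the sign of [dot T u] changes at most twice. The
      angle between two unit vectors is the measure of the set of directions [u]
      for which they lie on opposite sides; so the polygons inscribed in the curve
      [T] have length at most [2 pi] ([turning_le]). Difference quotients of [T]
      on finer and finer subdivisions converge to the curvature where it exists,
      and Fatou's lemma bounds its integral ([total_curvature_le]).

    The value on the disk requires all arc length parametrizations of a circle: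
    they are uniform rotations ([circle_param_rotation]), of curvature [1 / r]
    ([curvature_rotation]). *)

Set Implicit Arguments.
Unset Strict Implicit.
Unset Printing Implicit Defensive.

Local Notation enorm := euclidean_norm.

(** * Plane vectors *)

Section plane.
Context {R : realType}.
Implicit Types (p q u v : R * R) (x a b : R).

Definition dot p q : R := p.1 * q.1 + p.2 * q.2.

Definition dir x : R * R := (cos x, sin x).

Lemma dotC p q : dot p q = dot q p.
Proof. by rewrite /dot mulrC [p.2 * _]mulrC. Qed.

Lemma dotBl p q u : dot (p - q) u = dot p u - dot q u.
Proof. by rewrite /dot /=; ring. Qed.

Lemma dotDl p q u : dot (p + q) u = dot p u + dot q u.
Proof. by rewrite /dot /=; ring. Qed.

Lemma dotDr p q u : dot u (p + q) = dot u p + dot u q.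
Proof. by rewrite /dot /=; ring. Qed.

Lemma dotNr p u : dot u (- p) = - dot u p.
Proof. by rewrite /dot /=; ring. Qed.

Lemma dotZl k p q : dot (k *: p) q = k * dot p q.
Proof. by rewrite /dot /= /GRing.scale /=; ring. Qed.

Lemma dotZr k p q : dot p (k *: q) = k * dot p q.
Proof. by rewrite dotC dotZl dotC. Qed.

Lemma enorm_ge0 p : 0 <= enorm p.
Proof. exact: sqrtr_ge0. Qed.

Lemma sqr_enorm p : enorm p ^+ 2 = dot p p.
Proof. by rewrite sqr_sqrtr ?addr_ge0 ?sqr_ge0. Qed.

Lemma enorm_le p x : 0 <= x -> dot p p <= x ^+ 2 -> enorm p <= x.
Proof.
move=> x0; rewrite -sqr_enorm => h.
by rewrite -(@ler_pXn2r _ 2) ?nnegrE ?enorm_ge0.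
Qed.

Lemma enorm_eq p x : 0 <= x -> dot p p = x ^+ 2 -> enorm p = x.
Proof.
move=> x0 h; rewrite /euclidean_norm -[RHS]ger0_norm// -sqrtr_sqr -h.
by rewrite /dot -!expr2.
Qed.

Lemma normr_dot_le p q : `|dot p q| <= enorm p * enorm q.
Proof.
rewrite -(@ler_pXn2r _ 2) ?nnegrE ?mulr_ge0 ?enorm_ge0// exprMn !sqr_enorm.
rewrite real_normK ?num_real// -subr_ge0.
suff -> : dot p p * dot q q - dot p q ^+ 2 = (p.1 * q.2 - p.2 * q.1) ^+ 2.
  exact: sqr_ge0.
by rewrite /dot; ring.
Qed.

Lemma dot_le p q : dot p q <= enorm p * enorm q.
Proof. exact: le_trans (ler_norm _) (normr_dot_le p q). Qed.

Lemma enormZ k p : enorm (k *: p) = `|k| * enorm p.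
Proof.
apply: enorm_eq; first by rewrite mulr_ge0 ?enorm_ge0.
by rewrite dotZl dotZr exprMn sqr_enorm real_normK ?num_real//; ring.
Qed.

Lemma enormN p : enorm (- p) = enorm p.
Proof. by rewrite -scaleN1r enormZ normrN1 mul1r. Qed.

Lemma enormC p q : enorm (p - q) = enorm (q - p).
Proof. by rewrite -enormN opprB. Qed.

Lemma enormD p q : enorm (p + q) <= enorm p + enorm q.
Proof.
apply: enorm_le; first by rewrite addr_ge0 ?enorm_ge0.
rewrite dotDl !dotDr [dot q p]dotC sqrrD !sqr_enorm.
have := dot_le p q; lra.
Qed.

Lemma enorm0 : enorm (0 : R * R) = 0.
Proof. by apply: enorm_eq; rewrite // /dot /=; ring. Qed.

Lemma enorm_eq0 p : enorm p = 0 -> p = 0.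
Proof.
move=> p0; have : dot p p = 0 by rewrite -sqr_enorm p0 expr0n.
case: p {p0} => p1 p2; rewrite /dot /= => p0.
have h1 : p1 ^+ 2 = 0.
  by have := sqr_ge0 p1; have := sqr_ge0 p2; rewrite !expr2; lra.
have h2 : p2 ^+ 2 = 0 by rewrite expr2 in h1; rewrite expr2; lra.
by move/eqP: h1; move/eqP: h2; rewrite !sqrf_eq0 => /eqP-> /eqP->.
Qed.

Lemma normr_fst_le p : `|p.1| <= enorm p.
Proof.
rewrite -sqrtr_sqr ler_sqrt ?addr_ge0 ?sqr_ge0//.
by rewrite lerDl sqr_ge0.
Qed.

Lemma normr_snd_le p : `|p.2| <= enorm p.
Proof.
rewrite -sqrtr_sqr ler_sqrt ?addr_ge0 ?sqr_ge0//.
by rewrite lerDr sqr_ge0.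
Qed.

Lemma enorm_le_sum p : enorm p <= `|p.1| + `|p.2|.
Proof.
apply: enorm_le; first by rewrite addr_ge0.
rewrite sqrrD !real_normK ?num_real// /dot -!expr2.
by have : 0 <= `|p.1| * `|p.2| by []; lra.
Qed.

(** * Angles *)

Lemma normr_sin_le x : `|sin x| <= `|x|.
Proof.
wlog x0 : x / 0 < x.
  move=> h; have [/h//|x0|<-] := ltgtP 0 x; last by rewrite sin0 normr0.
  by rewrite -normrN -sinN -[leRHS]normrN; apply: h; rewrite oppr_gt0.
have [|c _] := @MVT R sin cos 0 x x0 (fun y _ => is_derive_sin y).
  by apply: continuous_subspaceT => y; exact: continuous_sin.
rewrite sin0 !subr0 => ->; rewrite normrM ler_piMl//.
exact: cos_max.
Qed.

Lemma cos_double x : cos x = 1 - 2 * sin (x / 2) ^+ 2.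
Proof.
rewrite {1}(splitr x) cosD -!expr2 cos2sin2; ring.
Qed.

Lemma two_subr_cos_le x : 2 - 2 * cos x <= x ^+ 2.
Proof.
rewrite cos_double.
have h := normr_sin_le (x / 2).
have : `|sin (x/2)| ^+ 2 <= `|x / 2| ^+ 2.
  by rewrite ler_pXn2r ?nnegrE.
rewrite !real_normK ?num_real// => {}h.
have -> : x ^+ 2 = 4 * (x / 2) ^+ 2 by field.
lra.
Qed.

Lemma dot_dir x y : dot (dir x) (dir y) = cos (x - y).
Proof. by rewrite cosB. Qed.

Lemma enorm_dir x : enorm (dir x) = 1.
Proof. by apply: enorm_eq => //; rewrite dot_dir subrr cos0 expr1n. Qed.

(** A chord is at most as long as its arc. *)
Lemma enorm_dirB_le x y : enorm (dir x - dir y) <= `|x - y|.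
Proof.
apply: enorm_le => //.
have -> : dot (dir x - dir y) (dir x - dir y) = 2 - 2 * cos (x - y).
  rewrite dotBl !dotDr !dotNr !dot_dir !subrr cos0 -[y - x]opprB cosN.
  ring.
by rewrite real_normK ?num_real//; exact: two_subr_cos_le.
Qed.

(** Written as [(sin a, - cos a)] up to sign, a unit vector has dot product
    [sin (a - x)] with [dir x], up to the same sign; while [x] runs through
    [[0, pi]], it can change sign only at [x = a]. *)
Lemma unit_normal_angle p : enorm p = 1 -> exists (s : bool) (a : R),
  0 <= a <= pi /\ p = (-1) ^+ s *: dir (a - pi / 2).
Proof.
move=> p1.
have e : p.1 ^+ 2 + p.2 ^+ 2 = 1.
  by rewrite !expr2 -/(dot p p) -sqr_enorm p1 expr1n.
have p2 : -1 <= - p.2 <= 1.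
  by have := normr_snd_le p; rewrite p1 ler_norml; lra.
have p2' : -1 <= p.2 <= 1 by lra.
have dirE y : dir (y - pi / 2) = (sin y, - cos y).
  by rewrite /dir cosB sinB cos_pihalf sin_pihalf; congr pair; ring.
have [p1_ge0|/ltW p1_le0] := leP 0 p.1.
  exists false, (acos (- p.2)); split; first by rewrite acos_ge0 ?acos_lepi.
  rewrite expr0 scale1r dirE sin_acos// acosK ?in_itv// sqrrN opprK.
  rewrite (_ : 1 - _ = p.1 ^+ 2); last by rewrite -e; ring.
  by rewrite sqrtr_sqr ger0_norm//; case: (p).
exists true, (acos p.2); split; first by rewrite acos_ge0 ?acos_lepi.
rewrite expr1 scaleN1r dirE sin_acos// acosK ?in_itv//.
rewrite (_ : 1 - _ = p.1 ^+ 2); last by rewrite -e; ring.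
rewrite sqrtr_sqr ler0_norm//; case: (p) => x y.
by rewrite -[- (_, _)]/(_, _)/= !opprK.
Qed.

Lemma dot_normal_angle x y : dot (dir (x - pi / 2)) (dir y) = sin (x - y).
Proof.
by rewrite dot_dir addrAC cosB cos_pihalf sin_pihalf mulr0 add0r mulr1.
Qed.

Lemma unit_dir p : enorm p = 1 -> exists2 x, 0 <= x < pi *+ 2 & p = dir x.
Proof.
move=> p1.
have e : p.1 ^+ 2 + p.2 ^+ 2 = 1 by rewrite !expr2 -/(dot p p) -sqr_enorm p1 expr1n.
have p2 : -1 <= p.1 <= 1.
  by have := normr_fst_le p; rewrite p1 ler_norml; lra.
have p2E : 1 - p.1 ^+ 2 = p.2 ^+ 2 by rewrite -e; ring.
have pi0 := pi_gt0 R.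
have [p2_ge0|p2_lt0] := leP 0 p.2.
  exists (acos p.1).
    rewrite acos_ge0//=; apply: le_lt_trans (acos_lepi p2) _; rewrite mulr2n; lra.
  rewrite /dir sin_acos// acosK ?in_itv// p2E sqrtr_sqr ger0_norm//.
  by case: (p).
exists (pi *+ 2 - acos p.1).
  rewrite subr_ge0 (le_trans (acos_lepi p2)) ?mulr2n; last lra.
  rewrite ltrBlDr ltrDl acos_gt0//.
  case/andP: p2 => -> /=; rewrite lt_neqAle => ->; rewrite andbT.
  apply/eqP => p11; move: p2E; rewrite p11 expr1n subrr => /esym/eqP.
  by rewrite sqrf_eq0 (lt_eqF p2_lt0).
rewrite /dir cosB sinB cos2pi sin2pi !mul0r !mul1r addr0 sub0r.
rewrite sin_acos// acosK ?in_itv// p2E sqrtr_sqr ltr0_norm// opprK.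
by case: (p).
Qed.

End plane.

(** * Averages over directions *)

Section integral_geometry.
Context {R : realType}.
Implicit Types (p q u v : R * R) (x a b : R).
Local Notation mu := (@lebesgue_measure R).

Lemma continuous_dot_dir v : continuous (fun x => dot v (dir x)).
Proof.
move=> x; rewrite /dot /dir /=; apply: cvgD; apply: cvgM;
  [exact: cvg_cst|exact: continuous_cos|exact: cvg_cst|exact: continuous_sin].
Qed.

Lemma mu_itv_ge a b (l r : bool) :
  ((b - a)%:E <= mu [set` Interval (BSide l a) (BSide r b)])%E.
Proof.
rewrite lebesgue_measure_itv/= lte_fin; case: ltP => // ba.
by rewrite lee_fin subr_le0.
Qed.

(** The directions are counted up to sign, hence the angles in [[0, pi]]. *)
Definition separating p q : set R :=
  [set x | x \in `[0, pi] /\ dot p (dir x) * dot q (dir x) < 0].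

Lemma measurable_separating p q : measurable (separating p q).
Proof.
have -> : separating p q = `[0, pi] `&`
    (fun x => dot p (dir x) * dot q (dir x)) @^-1` [set y | y < 0].
  by apply/seteqP; split.
apply: measurableI => //; apply: open_measurable.
apply: open_comp; last exact: open_lt.
by move=> x _; apply: cvgM; exact: continuous_dot_dir.
Qed.


Lemma separatingC p q : separating p q = separating q p.
Proof. by rewrite /separating; under eq_fun do rewrite mulrC. Qed.

(** The measure on the right is the angle between [p] and [q], that is, the arc
    of which the left-hand side is the chord. *)
Lemma enormB_le_separating p q : enorm p = 1 -> enorm q = 1 ->
  ((enorm (p - q))%:E <= mu (separating p q))%E.
Proof.
move=> /unit_normal_angle[s [a [a0pi ->]]] /unit_normal_angle[t [b [b0pi ->]]].
wlog ab : s t a b a0pi b0pi / a <= b.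
  move=> h; have [/h|/ltW/h] := leP a b; first exact.
  by rewrite enormC separatingC; exact.
have sin_gt0 x : 0 < x -> x < pi -> 0 < sin x.
  by move=> x0 xpi; apply: sin_gt0_pi; rewrite x0.
have subE x : separating ((-1) ^+ s *: dir (a - pi / 2))
      ((-1) ^+ t *: dir (b - pi / 2)) x <->
    0 <= x <= pi /\ (-1) ^+ (s (+) t) * sin (a - x) * sin (b - x) < 0.
  rewrite /separating /= in_itv /= !dotZl !dot_normal_angle signr_addb.
  by split=> -[? h]; split => //; apply: le_lt_trans h; nra.
have [st|st] := eqVneq s t.
  have -> : (-1) ^+ s *: dir (a - pi / 2) - (-1) ^+ t *: dir (b - pi / 2) =
      (-1) ^+ s *: (dir (a - pi / 2) - dir (b - pi / 2)).
    by rewrite st scalerBr.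
  rewrite enormZ normr_sign mul1r.
  apply: (@le_trans _ _ (mu `]a, b[)).
    apply: le_trans (mu_itv_ge _ _ _ _); rewrite lee_fin.
    apply: le_trans (enorm_dirB_le _ _) _.
    by rewrite ler0_norm; lra.
  apply: le_measure; rewrite ?inE//; first exact: measurable_separating.
  move=> x; rewrite /= in_itv/= => /andP[ax xb]; apply/subE; split; first lra.
  rewrite st addbb expr0 mul1r -opprB sinN.
  by have := sin_gt0 (x - a); have := sin_gt0 (b - x); nra.
have -> : (-1) ^+ s *: dir (a - pi / 2) - (-1) ^+ t *: dir (b - pi / 2) =
    (-1) ^+ s *: (dir (a - pi / 2) - dir (b - pi / 2 - pi)).
  rewrite scalerBr; congr (_ - _).
  have -> : dir (b - pi / 2 - pi) = - dir (b - pi / 2).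
    rewrite -[RHS]/(- cos _, - sin _) /dir (cosB _ pi) (sinB _ pi) cospi sinpi.
    by congr pair; ring.
  by rewrite scalerN -scaleNr; case: s t st {subE} => -[]//= _; rewrite expr0 expr1 ?opprK.
rewrite enormZ normr_sign mul1r.
apply: (@le_trans _ _ (mu (`]0, a[ `|` `]b, pi[))).
  rewrite measureU//; last first.
    apply/seteqP; split => // x [] /=; rewrite !in_itv/=; lra.
  apply: (@le_trans _ _ ((a - 0)%:E + (pi - b)%:E)%E).
    rewrite -EFinD lee_fin; apply: le_trans (enorm_dirB_le _ _) _.
    by rewrite ger0_norm; lra.
  by apply: leeD; exact: mu_itv_ge.
apply: le_measure; rewrite ?inE//.
  by apply: measurableU.
  exact: measurable_separating.
have st1 : s (+) t = true by case: s t st {subE} => -[].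
rewrite st1 in subE; move=> x [] /=; rewrite in_itv/= => /andP[ax xb];
  apply/subE; split; try lra.
  rewrite expr1.
  by have := sin_gt0 (a - x); have := sin_gt0 (b - x); nra.
rewrite expr1 -opprB sinN -[b - x]opprB sinN.
by have := sin_gt0 (x - a); have := sin_gt0 (x - b); nra.
Qed.


Let measurable_indic_separating p q (D : set R) :
  measurable_fun D (fun x => (\1_(separating p q) x)%:E : \bar R).
Proof.
apply/measurable_EFinP; apply: measurable_indic; exact: measurable_separating.
Qed.

(** Each direction separates at most two consecutive pairs, and the directions
    form a set of measure [pi]. *)
Lemma turning_le n (t : nat -> R * R) :
  (forall k, (k <= n)%N -> enorm (t k) = 1) ->
  (forall x,
     (\sum_(k < n) (dot (t k) (dir x) * dot (t k.+1) (dir x) < 0)%R <= 2)%N) ->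
  \sum_(k < n) enorm (t k.+1 - t k) <= 2 * pi.
Proof.
move=> t1 turns; rewrite -lee_fin -sumEFin.
apply: (@le_trans _ _ (\sum_(k < n) mu (separating (t k) (t k.+1)))%E).
  apply: lee_sum => -[k /= kn] _; rewrite enormC.
  by apply: enormB_le_separating; rewrite t1// ltnW.
have sepE k : mu (separating (t k) (t k.+1)) =
    (\int[mu]_(x in `[0%R, pi]) (\1_(separating (t k) (t k.+1)) x)%:E)%E.
  rewrite integral_indic//; last exact: measurable_separating.
  by congr (mu _); apply/esym/setIidl => x [].
under eq_bigr do rewrite sepE.
rewrite -(@ge0_integral_sum _ _ _ mu _ (measurable_itv _) _
    (fun (k : 'I_n) (x : R) => (\1_(separating (t k) (t k.+1)) x)%:E)); last 2 first.
- by move=> k; exact: measurable_indic_separating.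
- by move=> k x _; rewrite lee_fin.
apply: (@le_trans _ _ (\int[mu]_(x in `[0%R, pi]) (cst 2%:E x))%E).
  apply: ge0_le_integral => //.
  - by move=> x _; apply: sume_ge0 => k _; rewrite lee_fin.
  - apply: emeasurable_sum => k.
    exact: measurable_indic_separating.
  move=> x xpi; rewrite /= sumEFin lee_fin.
  apply: (@le_trans _ _ ((\sum_(k < n)
      (dot (t k) (dir x) * dot (t k.+1) (dir x) < 0)%R)%N%:R)); last first.
    by rewrite ler_nat.
  rewrite natr_sum; apply: ler_sum => k _; rewrite indicE ler_nat.
  by case: (boolP (x \in _)) => // /set_mem[_ ->].
rewrite integral_cst//= lebesgue_measure_itv/= lte_fin pi_gt0 oppr0 adde0.
by rewrite -EFinM.
Qed.

Lemma integral_sin_shift a b c : a <= b ->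
  (\int[mu]_(x in `[a, b]) (sin (x - c))%:E = (cos (a - c) - cos (b - c))%:E)%E.
Proof.
rewrite le_eqVlt => /predU1P[->|ab].
  by rewrite set_itv1 integral_set1 subrr.
have dc x : is_derive x 1 (fun x => - cos (x - c)) (sin (x - c)).
  by apply: is_derive_eq; rewrite subr0 mulr1 opprK.
have cc : continuous (fun x => - cos (x - c)).
  by move=> x; apply: differentiable_continuous; apply/derivable1_diffP; have [] := dc x.
rewrite (@continuous_FTC2 _ _ (fun x => - cos (x - c)))//.
- by rewrite -EFinB opprK addrC.
- apply: continuous_subspaceT => x; apply: continuous_comp.
    by apply: cvgB; [exact: cvg_id|exact: cvg_cst].
  exact: continuous_sin.
- split.
  + by move=> x _; have [] := dc x.
  + exact/cvg_at_right_filter/cc.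
  + exact/cvg_at_left_filter/cc.
- by move=> x _; rewrite derive1E; have [_ ->] := dc x.
Qed.

(** Cauchy's formula: the mean of the lengths of the projections of a segment
    is a fixed multiple of its length. *)
Lemma integral_normr_dot_ge v :
  ((2 * enorm v)%:E <= \int[mu]_(x in `[0%R, pi]) `|dot v (dir x)|%:E)%E.
Proof.
have [v0|v0] := eqVneq (enorm v) 0.
  by rewrite v0 mulr0; apply: integral_ge0 => x _; rewrite lee_fin.
have v1 : enorm ((enorm v)^-1 *: v) = 1.
  by rewrite enormZ ger0_norm ?invr_ge0 ?enorm_ge0// mulVf.
have [s [a [/andP[a0 api] ve]]] := unit_normal_angle v1.
have {ve} vE x : `|dot v (dir x)| = enorm v * `|sin (x - a)|.
  rewrite -[v in dot v](@scalerKV _ _ (enorm v)) ?unitfE// ve !dotZl.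
  rewrite dot_normal_angle !normrM normr_sign mul1r ger0_norm ?enorm_ge0//.
  by rewrite -(opprB x) sinN normrN.
under eq_integral do rewrite vE EFinM.
have cs : continuous (fun x => sin (x - a)).
  move=> x; apply: continuous_comp; last exact: continuous_sin.
  by apply: cvgB; [exact: cvg_id|exact: cvg_cst].
have ms (A : set R) : measurable_fun A (fun x => (`|sin (x - a)|)%:E).
  apply/measurable_EFinP; apply: measurable_funTS.
  apply: continuous_measurable_fun => x.
  by apply: continuous_comp; [exact: cs|exact: norm_continuous].
rewrite ge0_integralZl_EFin//; [|exact: ms|exact: enorm_ge0].
rewrite mulrC EFinM lee_wpmul2l ?lee_fin ?enorm_ge0//.
have -> : `[0, pi]%classic = `[0, a] `|` `]a, pi] :> set R.
  by rewrite -itv_bndbnd_setU ?bnd_simp.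
rewrite ge0_integral_setU//; last first.
  by apply/disj_setPS => x [] /=; rewrite !in_itv/=; lra.
  exact: ms.
rewrite integral_itv_obnd_cbnd; last exact: ms.
have -> : (\int[mu]_(x in `[0%R, a]) `|sin (x - a)|%:E =
    \int[mu]_(x in `[0%R, a]) (sin (x - (a - pi)))%:E)%E.
  apply: eq_integral => x; rewrite inE/= in_itv/= => xa.
  rewrite opprB addrCA addrC sinDpi ler0_norm// -oppr_ge0 -sinN.
  by rewrite sin_ge0_pi//; lra.
have -> : (\int[mu]_(x in `[a, pi]) `|sin (x - a)|%:E =
    \int[mu]_(x in `[a, pi]) (sin (x - a))%:E)%E.
  apply: eq_integral => x; rewrite inE/= in_itv/= => xa.
  by rewrite ger0_norm// sin_ge0_pi//; lra.
rewrite !integral_sin_shift// -EFinD lee_fin.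
have -> : 0 - (a - pi) = pi - a by ring.
have -> : a - (a - pi) = pi by ring.
by rewrite subrr cos0 cospi; lra.
Qed.

(** Cauchy's formula, summed over the edges. The gain [h] in the directions of
    [[a, b]] is what makes the disk the only maximizer. *)
Lemma polygon_length_le n (G : nat -> R * R) W h a b : 0 <= h -> a <= b ->
  `[a, b] `<=` `[0, pi] ->
  (forall x, \sum_(k < n) `|dot (G k.+1 - G k) (dir x)| <= W) ->
  (forall x, x \in `[a, b] ->
     \sum_(k < n) `|dot (G k.+1 - G k) (dir x)| <= W - h) ->
  2 * \sum_(k < n) enorm (G k.+1 - G k) <= W * pi - h * (b - a).
Proof.
move=> h0 ab abpi GW GWh.
pose S x := \sum_(k < n) `|dot (G k.+1 - G k) (dir x)|.
have md v : measurable_fun `[0, pi] (fun x => `|dot v (dir x)|%:E).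
  apply/measurable_EFinP; apply: measurable_funTS.
  apply: continuous_measurable_fun => x.
  apply: (@continuous_comp _ _ _ (fun x => dot v (dir x)) (fun y => `|y|)).
    exact: continuous_dot_dir.
  exact: norm_continuous.
have SE x : (S x)%:E = (\sum_(k < n) `|dot (G k.+1 - G k) (dir x)|%:E)%E.
  by rewrite sumEFin.
have mS : measurable_fun `[0, pi] (fun x => (S x)%:E).
  rewrite (_ : (fun x => (S x)%:E) =
      (fun x => \sum_(k < n) `|dot (G k.+1 - G k) (dir x)|%:E)%E); last first.
    by apply/funext => x; exact: SE.
  by apply: emeasurable_sum => k; exact: md.
have mI : measurable_fun `[0, pi] (fun x => (\1_`[a, b] x)%:E : \bar R).
  by apply/measurable_EFinP/measurable_indic.
have : ((2 * \sum_(k < n) enorm (G k.+1 - G k))%:E <=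
    \int[mu]_(x in `[0%R, pi]) (S x)%:E)%E.
  rewrite mulr_sumr -sumEFin; under eq_integral do rewrite SE.
  rewrite (@ge0_integral_sum _ _ _ mu _ (measurable_itv _) _
    (fun (k : 'I_n) (x : R) => (`|dot (G k.+1 - G k) (dir x)|)%:E));
    [|by move=> k; exact: md|by []].
  by apply: lee_sum => k _; exact: integral_normr_dot_ge.
have : (\int[mu]_(x in `[0%R, pi]) ((S x)%:E + h%:E * (\1_`[a, b] x)%:E) <=
        \int[mu]_(x in `[0%R, pi]) (cst W%:E x))%E.
  apply: ge0_le_integral => //.
  - by move=> x _; rewrite -EFinM -EFinD lee_fin addr_ge0 ?mulr_ge0// sumr_ge0.
  - by apply: emeasurable_funD => //; exact: measurable_funeM.
  move=> x _; rewrite -EFinM -EFinD lee_fin indicE.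
  case: (boolP (x \in _)) => [/set_mem xab|_]; last by rewrite mulr0 addr0 GW.
  by rewrite mulr1 -lerBrDr GWh.
rewrite integral_cst//= lebesgue_measure_itv/= lte_fin pi_gt0 oppr0 adde0.
rewrite ge0_integralD//; last 3 first.
- by move=> x _; rewrite lee_fin sumr_ge0.
- by move=> x _; rewrite -EFinM lee_fin mulr_ge0.
- exact: measurable_funeM.
rewrite ge0_integralZl_EFin// integral_indic// setIidl//.
have muab : mu `[a, b] = (b - a)%:E.
  rewrite lebesgue_measure_itv/= lte_fin; case: ltP => // ba.
  by congr EFin; apply/eqP; rewrite eq_sym subr_eq0 eq_le ab ba.
move: muab => /= ->; rewrite -!EFinM => h1 h2.
rewrite -lee_fin EFinB leeBrDr//; apply: le_trans h1.
exact: leeD2r.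
Qed.

End integral_geometry.

(** * Functions with one rise and one fall *)

Section two_turns.
Context {R : realType}.
Implicit Types (f g : R -> R) (l m M x y : R).

Definition ndecr f a b := forall x y, a <= x -> x <= y -> y <= b -> f x <= f y.

Definition up_down_up f l m M :=
  [/\ 0 <= m, m <= M, M <= l &
      [/\ ndecr f 0 m, ndecr (fun x => - f x) m M & ndecr f M l]].

(** Read cyclically, with [0] and [l] identified: one rise and one fall. *)
Definition two_turns f l m M :=
  up_down_up f l m M \/ up_down_up (fun x => - f x) l m M.

Lemma two_turnsN f l m M : two_turns (fun x => - f x) l m M -> two_turns f l m M.
Proof.
case=> -[m0 mM Ml [h1 h2 h3]]; [right|left] => //.
by split=> //; split=> x y xa xy yb;
  [have := h1 x y xa xy yb|have := h2 x y xa xy yb|have := h3 x y xa xy yb];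
  rewrite !opprK.
Qed.

Lemma IVT_strict f a b t : a < b -> {within `[a, b], continuous f} ->
  (f a < t /\ t < f b) \/ (f b < t /\ t < f a) ->
  exists2 c, a < c < b & f c = t.
Proof.
move=> ab cf ft.
have [|c] := @IVT _ f a b t (ltW ab) cf.
  by rewrite ge_min le_max; case: ft => -[/ltW-> /ltW->]; rewrite ?orbT.
rewrite in_itv/= => /andP[ac cb] fc; exists c => //.
rewrite !lt_neqAle ac cb !andbT; apply/andP; split; apply/eqP => e.
  by move: ft; rewrite -fc e; lra.
by move: ft; rewrite -fc -e; lra.
Qed.

(** Hits are counted at interior times, the two ends being the same point of a
    closed curve; the level has to lie strictly between the extrema, since a
    convex curve may follow a supporting line for a while. *)
Definition levels_met_twice f l := forall x y z t,
  0 < x -> x < y -> y < z -> z < l -> f x = t -> f y = t -> f z = t ->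
  (exists2 w, 0 <= w <= l & f w < t) -> (exists2 w, 0 <= w <= l & t < f w) ->
  False.

(** The intermediate value theorem gives three crossings of a zigzag. *)
Lemma no_zigzag f l a b d e : {within `[0, l], continuous f} ->
  levels_met_twice f l -> 0 <= a -> a <= b -> b <= d -> d <= e -> e <= l ->
  f b < f a -> f b < f d -> f e < f a -> f e < f d -> False.
Proof.
move=> cf lev a0 ab bd de el fba fbd fea fed.
have neq x y : f x != f y -> x <= y -> x < y.
  by move=> fxy xy; rewrite lt_neqAle xy andbT; apply: contra_neq fxy => ->.
have {}ab : a < b by apply: neq ab; rewrite gt_eqF.
have {}bd : b < d by apply: neq bd; rewrite lt_eqF.
have {neq}de : d < e by apply: neq de; rewrite gt_eqF.
have cross x y t : 0 <= x -> x < y -> y <= l ->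
    (f x < t /\ t < f y) \/ (f y < t /\ t < f x) ->
    exists2 c, x < c < y & f c = t.
  move=> x0 xy yl; apply: IVT_strict => //.
  by apply: continuous_subspaceW cf => z /=; rewrite !in_itv/=; lra.
have /midf_lt : Num.max (f b) (f e) < Num.min (f a) (f d).
  by rewrite gt_max !lt_min fba fbd fea fed.
move: (_ / 2) => t; rewrite gt_max lt_min => -[/andP[tb te] /andP[ta td]].
have [||x /andP[ax xb] fx] := cross a b t a0 ab; [lra|by right|].
have [|||y /andP[by_ yd] fy] := cross b d t _ bd; [lra|lra|by left|].
have [|||z /andP[dz ze] fz] := cross d e t _ de; [lra|lra|by right|].
apply: (lev x y z t) => //; first lra.
- lra.
- lra.
- lra.
- by exists b; [lra|].
- by exists a; [lra|].
Qed.

(** A failure of monotonicity between the places of the extrema, or outside,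
    makes a zigzag together with these places. *)
Lemma two_turns_of_levels f l : 0 <= l -> {within `[0, l], continuous f} ->
  levels_met_twice f l -> exists m M, two_turns f l m M.
Proof.
move=> l0 cf lev.
have [m] := EVT_max l0 cf; rewrite in_itv/= => /andP[m0 ml] fm.
have [M] := EVT_min l0 cf; rewrite in_itv/= => /andP[M0 Ml] fM.
have {}fm x : 0 <= x -> x <= l -> f x <= f m.
  by move=> x0 xl; apply: fm; rewrite in_itv/= x0.
have {}fM x : 0 <= x -> x <= l -> f M <= f x.
  by move=> x0 xl; apply: fM; rewrite in_itv/= x0.
wlog mM : f cf m M fm fM m0 ml M0 Ml lev / m <= M => [h|].
  have [mM|/ltW Mm] := leP m M; first exact: (h f cf m M).
  have [||||m' [M' d]] // := h (fun x => - f x) _ M m _ _ M0 Ml m0 ml _ Mm.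
  - by move=> x; apply: cvgN; exact: cf.
  - by move=> x x0 xl; rewrite lerN2; exact: fM.
  - by move=> x x0 xl; rewrite lerN2; exact: fm.
  - move=> x y z t x0 xy yz zl fx fy fz [w wl fw] [v vl fv].
    apply: (lev x y z (- t)) => //; try by rewrite -(opprK (f _)); congr (- _).
      by exists v => //; rewrite ltrNr.
    by exists w => //; rewrite ltrNl.
  - by exists m', M'; exact: two_turnsN.
have zig := no_zigzag cf lev.
exists m, M; left; split => //; split => x y ax xy yb; rewrite leNgt ?ltrN2;
  apply/negP => fxy.
- have := fm x ax; have := fM y (le_trans ax xy) => fMy fxm.
  by apply: (zig x y m M) => //; lra.
- have := fm y; have := fM x => fMx fym.
  by apply: (zig m x y M) => //; lra.
- have := fm x; have := fM y => fMy fxm.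
  by apply: (zig m M x y) => //; lra.
Qed.

(** The condition [f 0 = f l] joins the two outer pieces into one, so that [f]
    goes once from its minimum to its maximum and back. *)
Lemma two_turns_variation f l m M W n (s : nat -> R) :
  two_turns f l m M -> f 0 = f l ->
  (forall x y, 0 <= x <= l -> 0 <= y <= l -> f x - f y <= W) ->
  (forall k, (k < n)%N -> s k <= s k.+1) ->
  (forall k, (k <= n)%N -> 0 <= s k <= l) ->
  \sum_(k < n) `|f (s k.+1) - f (s k)| <= 2 * W.
Proof.
wlog : f / up_down_up f l m M.
  move=> h [d|d] f0l fW; first by apply: h => //; left.
  move=> sn sl; have -> : \sum_(k < n) `|f (s k.+1) - f (s k)| =
      \sum_(k < n) `|(fun x => - f x) (s k.+1) - (fun x => - f x) (s k)|.
    by apply: eq_bigr => k _; rewrite -normrN opprB opprK addrC.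
  apply: (h (fun x => - f x)) => //; [by left|by rewrite f0l|].
  by move=> x y hx hy; rewrite opprK addrC; exact: fW.
case=> m0 mM Ml [h1 h2 h3] _ f0l fW sn sl.
(* The total variation of [f] on [[0, x]], up to a constant. *)
pose g x := if x <= m then f x else
  if x <= M then 2 * f m - f x else 2 * f m - 2 * f M + f x.
have fm x : 0 <= x <= l -> f M <= f x <= f m.
  move=> /andP[x0 xl].
  have := h1 0 m; have := h2 m M; have := h3 M l.
  have := h1 0 x; have := h1 x m; have := h2 m x; have := h2 x M.
  have := h3 M x; have := h3 x l.
  have [xm|mx] := leP x m; first by lra.
  have [xM|Mx] := leP x M; lra.
have gf x y : 0 <= x -> x <= y -> y <= l -> `|f y - f x| <= g y - g x.
  move=> x0 xy yl; rewrite /g.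
  have [xm|mx] := leP x m; have [ym|my] := leP y m; try lra.
  - by have := h1 x y x0 xy ym; rewrite -subr_ge0 => /ger0_norm->.
  - have := h1 x m x0 xm (lexx _) => ?.
    have [yM|My] := leP y M.
      by have := h2 m y (lexx _) (ltW my) yM; rewrite ler_norml; lra.
    have := h2 m M (lexx _) mM (lexx _).
    by have := h3 M y (lexx _) (ltW My) yl; rewrite ler_norml; lra.
  - have [xM|Mx] := leP x M; have [yM|My] := leP y M; try lra.
    + by have := h2 x y (ltW mx) xy yM; rewrite ler_norml; lra.
    + have := h2 x M (ltW mx) xM (lexx _).
      by have := h3 M y (lexx _) (ltW My) yl; rewrite ler_norml; lra.
    + by have := h3 x y (ltW Mx) xy yl; rewrite ler_norml; lra.
have gW x y : 0 <= x -> x <= y -> y <= l -> g y - g x <= 2 * (f m - f M).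
  move=> x0 xy yl; rewrite /g.
  have fx := fm x; have fy := fm y; have f00 := fm 0.
  have := h1 0 x; have := h3 y l; have := h1 0 m; have := h3 M l.
  have [xm|mx] := leP x m; have [ym|my] := leP y m; try lra.
    by have [yM|My] := leP y M; lra.
  by have [xM|Mx] := leP x M; have [yM|My] := leP y M; lra.
have s0n k : (k <= n)%N -> s 0%N <= s k.
  by elim: k => // k ih kn; apply: le_trans (ih (ltnW kn)) (sn _ kn).
apply: (@le_trans _ _ (g (s n) - g (s 0%N))).
  rewrite -(telescope_sumr (g \o s))// big_mkord; apply: ler_sum => -[k kn] _ /=.
  by apply: gf; [have := sl k (ltnW kn)|exact: sn|have := sl k.+1 kn]; lra.
apply: (@le_trans _ _ (2 * (f m - f M))).
  by have := s0n n (leqnn _); have := sl 0%N (leq0n _); have := sl n (leqnn _) => ? ? ?;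
    apply: gW; lra.
by have := fW m M; lra.
Qed.

(** The function [e] stands for the right derivative of [f], whose sign can
    only change at the two turns. *)
Lemma two_turns_sign_changes f l m M n (s : nat -> R) (e : R -> R) :
  two_turns f l m M ->
  (forall x d, 0 <= x -> x < d -> d <= l -> ndecr f x d -> 0 <= e x) ->
  (forall x d, 0 <= x -> x < d -> d <= l -> ndecr (fun x => - f x) x d ->
     e x <= 0) ->
  (forall k, (k < n)%N -> s k <= s k.+1) ->
  (forall k, (k <= n)%N -> 0 <= s k < l) ->
  (\sum_(k < n) (e (s k) * e (s k.+1) < 0)%R <= 2)%N.
Proof.
wlog : f e / up_down_up f l m M.
  move=> h [d|d] ef ef'; first by apply: (h f e) => //; left.
  move=> sn sl; have -> : (\sum_(k < n) (e (s k) * e (s k.+1) < 0)%R =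
      \sum_(k < n) ((fun x => - e x) (s k) * (fun x => - e x) (s k.+1) < 0)%R)%N.
    by apply: eq_bigr => k _; rewrite mulrNN.
  apply: (h (fun x => - f x) (fun x => - e x)) => //; first by left.
  - by move=> x y x0 xy yl fxy; rewrite oppr_ge0; apply: ef' xy yl fxy.
  - move=> x y x0 xy yl fxy; rewrite oppr_le0; apply: ef xy yl _ => // a b xa ab bd.
    by have := fxy a b xa ab bd; rewrite !opprK.
case=> m0 mM Ml [h1 h2 h3] _ ef ef' sn sl.
(* The number of turns up to [x]. *)
pose g x : nat := ((m <= x)%R + (M <= x)%R)%N.
have e1 x : 0 <= x -> x < m -> 0 <= e x.
  move=> x0 xm; apply: (ef x m) => //; first lra.
  by move=> a b xa ab bm; apply: h1; lra.
have e2 x : m <= x -> x < M -> e x <= 0.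
  move=> xm xM; apply: (ef' x M) => //; first lra.
  by move=> a b xa ab bm; apply: h2; lra.
have e3 x : M <= x -> x < l -> 0 <= e x.
  move=> Mx xl; apply: (ef x l) => //; first lra.
  by move=> a b xa ab bm; apply: h3; lra.
have step x y : 0 <= x -> x <= y -> y < l ->
    ((e x * e y < 0)%R + g x <= g y)%N.
  move=> x0 xy yl; rewrite /g.
  have p (a b : R) : 0 <= a -> 0 <= b -> (a * b < 0) = false.
    by move=> a0 b0; rewrite ltNge mulr_ge0.
  have q (a b : R) : a <= 0 -> b <= 0 -> (a * b < 0) = false.
    by move=> a0 b0; rewrite ltNge mulr_le0.
  have [mx|xm] := leP m x; last first.
    rewrite (_ : M <= x = false); last by apply/negbTE; rewrite -ltNge; lra.
    have [my|ym] := leP m y; first by case: (_ < 0); case: (M <= y).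
    rewrite p; [|exact: e1|apply: e1 => //; lra].
    by case: (M <= y).
  have -> : m <= y by lra.
  have [Mx|xM] := leP M x.
    have -> : M <= y by lra.
    by rewrite p//; apply: e3; lra.
  have [My|yM] := leP M y; first by case: (_ < 0).
  by rewrite q//; apply: e2; lra.
have : (\sum_(k < n) (e (s k) * e (s k.+1) < 0)%R + g (s 0) <= g (s n))%N.
  elim: n sn sl => [|n ih] sn sl; first by rewrite big_ord0.
  rewrite big_ord_recr/= addnAC.
  have := ih (fun k kn => sn k (ltnW kn)) (fun k kn => sl k (leqW kn)).
  have := step (s n) (s n.+1); have := sl n (leqnSn _); have := sl n.+1 (leqnn _).
  move=> /andP[_ b] /andP[a _] /(_ a (sn n (ltnSn _)) b) h h'.
  by apply: leq_trans h; rewrite addnC leq_add2l.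
have : (g (s n) <= 2)%N by rewrite /g; case: (m <= _); case: (M <= _).
by move=> g2 h; apply: leq_trans g2; apply: leq_trans h; rewrite leq_addr.
Qed.

Lemma two_turns_right_monotone f l m M x : two_turns f l m M -> 0 <= x -> x < l ->
  exists2 d, x < d <= l & ndecr f x d \/ ndecr (fun x => - f x) x d.
Proof.
wlog : f / up_down_up f l m M.
  move=> h [d|d] x0 xl; first by apply: h => //; left.
  have [|c xc [g|g]] := h (fun x => - f x) d _ x0 xl; first by left.
    by exists c => //; right.
  exists c => //; left=> a b xa ab bc; have := g a b xa ab bc.
  by rewrite !opprK.
case=> m0 mM Ml [h1 h2 h3] _ x0 xl.
have [mx|xm] := leP m x; last first.
  exists m; first lra.
  by left=> a b xa ab bm; apply: h1; lra.
have [Mx|xM] := leP M x.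
  by exists l; [lra|left=> a b xa ab bm; apply: h3; lra].
by exists M; [lra|right=> a b xa ab bm; apply: h2; lra].
Qed.

End two_turns.

(** * Lines and the boundary of a convex set *)

Section convex_curves.
Context {R : realType}.
Implicit Types (C : set (R * R)) (p q u v w z : R * R) (gamma : R -> R * R).

Lemma convex_comb C p q (t : R) : convex_set (M := (R * R)%type) C ->
  C p -> C q -> 0 <= t <= 1 -> C (t *: p + (1 - t) *: q).
Proof.
move=> cC Cp Cq /andP[t0 t1].
by have := cC p q (Itv01 t0 t1); rewrite !inE => /(_ Cp Cq).
Qed.

Definition perp u : R * R := (- u.2, u.1).

Lemma dotpp_gt0 p : p != 0 -> 0 < dot p p.
Proof.
move=> p0; rewrite -sqr_enorm exprn_gt0// lt_neqAle enorm_ge0 andbT eq_sym.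
by apply: contra_neq p0; exact: enorm_eq0.
Qed.

Lemma eq_dot_orthogonal d u p q : d != 0 -> u != 0 -> dot d u = 0 ->
  dot p d = dot q d -> dot p u = dot q u -> p = q.
Proof.
move=> d0 u0 du pqd pqu; apply/eqP; rewrite -subr_eq0; apply/eqP.
have e1 : dot (p - q) d = 0 by rewrite dotBl pqd subrr.
have e2 : dot (p - q) u = 0 by rewrite dotBl pqu subrr.
pose D := d.1 * u.2 - d.2 * u.1.
have D0 : D != 0.
  have : 0 < D ^+ 2; last by rewrite lt_neqAle eq_sym sqrf_eq0 => /andP[].
  have -> : D ^+ 2 = dot d d * dot u u - dot d u ^+ 2 by rewrite /dot /D; ring.
  by rewrite du expr0n subr0 mulr_gt0// dotpp_gt0.
move: (p - q) e1 e2 => [x y]; rewrite /dot /= => e1 e2.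
have xD : x * D = 0.
  have -> : x * D = (x * d.1 + y * d.2) * u.2 - (x * u.1 + y * u.2) * d.2.
    by rewrite /D; ring.
  by rewrite e1 e2 !mul0r subrr.
have yD : y * D = 0.
  have -> : y * D = (x * u.1 + y * u.2) * d.1 - (x * d.1 + y * d.2) * u.1.
    by rewrite /D; ring.
  by rewrite e1 e2 !mul0r subrr.
move/eqP: xD; move/eqP: yD; rewrite !mulf_eq0 (negbTE D0) !orbF.
by move=> /eqP-> /eqP->.
Qed.

Lemma near_dotB p u (e : R) : 0 < e -> \forall q \near p, `|dot (q - p) u| < e.
Proof.
move=> e0.
have : (fun q => dot (q - p) u) @ p --> (0 : R).
  have -> : 0 = (p - p).1 * u.1 + (p - p).2 * u.2 by rewrite subrr !mul0r addr0.
  have c : (fun q => q - p) @ p --> p - p by apply: cvgB; [exact: cvg_id|exact: cvg_cst].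
  apply: cvgD; apply: cvgM; try exact: cvg_cst.
    exact: (cvg_comp _ _ c cvg_fst).
  exact: (cvg_comp _ _ c cvg_snd).
by move/cvgr0_norm_lt; apply.
Qed.

(** Near [m] the barycentric coordinates of [y] in the triangle [p q z] are
    those of [m] up to a small error; that of [z] vanishes at [m], and its sign
    tells the side of the line [p q] on which [y] lies. *)
Lemma near_triangle C p q z u (a : R) : convex_set (M := (R * R)%type) C ->
  C p -> C q -> C z -> p != q -> 0 < a < 1 ->
  dot p u = dot q u -> dot p u < dot z u ->
  let m := a *: p + (1 - a) *: q in
  \forall y \near m, 0 <= dot (y - m) u -> C y.
Proof.
move=> cC Cp Cq Cz pq a01 pqu pzu m.
pose d := q - p; pose w := z - m.
have du : dot d u = 0 by rewrite dotBl pqu subrr.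
have mu : dot m u = dot p u by rewrite dotDl !dotZl -pqu; ring.
pose c := dot w u.
have c0 : 0 < c by rewrite /c dotBl mu subr_gt0.
have dd0 : 0 < dot d d.
  rewrite -sqr_enorm exprn_gt0// lt_neqAle enorm_ge0 andbT eq_sym.
  by apply: contra_neq pq => /enorm_eq0/eqP; rewrite subr_eq0 => /eqP.
have u0 : u != 0.
  by apply/eqP => u0; move: c0; rewrite /c u0 /dot /= !mulr0 addr0 ltxx.
pose e := Num.min a (1 - a) / 2.
have e0 : 0 < e by rewrite divr_gt0// lt_min; lra.
have ea : e <= a / 2 /\ e <= (1 - a) / 2.
  by split; rewrite ler_pM2r// ge_min lexx ?orbT.
have k0 : 0 < 1 + `|dot w d| by rewrite ltr_wpDr.
have h1 : 0 < e * dot d d / 2 by rewrite divr_gt0// mulr_gt0.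
have h2 : 0 < c / 2 by rewrite divr_gt0.
have h3 : 0 < e * dot d d / 2 * c / (1 + `|dot w d|) by rewrite divr_gt0// mulr_gt0.
near=> y => v0.
have v1 : `|dot (y - m) d| < e * dot d d / 2 by near: y; exact: near_dotB.
have v2 : `|dot (y - m) u| < c / 2 by near: y; exact: near_dotB.
have v3 : `|dot (y - m) u| < e * dot d d / 2 * c / (1 + `|dot w d|).
  by near: y; exact: near_dotB.
rewrite ger0_norm// in v2 v3.
pose b := dot (y - m) u / c.
have b0 : 0 <= b by rewrite divr_ge0// ltW.
have b1 : b < 1 / 2 by rewrite ltr_pdivrMr//; lra.
have bw : `|b * dot w d| <= e * dot d d / 2.
  rewrite normrM ger0_norm//; apply: (@le_trans _ _ (b * (1 + `|dot w d|))).
    by rewrite ler_wpM2l// lerDr.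
  by rewrite -ler_pdivlMr// ler_pdivrMr// mulrAC ltW.
pose f := (dot (y - m) d - b * dot w d) / dot d d.
have fe : `|f| < e.
  rewrite normrM normfV (gtr0_norm dd0) ltr_pdivrMr//.
  by apply: le_lt_trans (ler_normB _ _) _; lra.
have [f1 f2] : - e < f /\ f < e by move: fe; rewrite ltr_norml => /andP.
have yE : y - m = b *: w + f *: d.
  apply: (@eq_dot_orthogonal d u) => //.
  - by apply/eqP => d0; move: dd0; rewrite d0 /dot /= !mulr0 addr0 ltxx.
  - by rewrite [RHS]dotDl !dotZl /f divfK ?gt_eqF//; ring.
  - by rewrite [RHS]dotDl !dotZl du mulr0 addr0 divfK ?gt_eqF.
have b1' : 1 - b != 0 by rewrite gt_eqF//; lra.
pose g := ((1 - b) * a - f) / (1 - b).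
have -> : y = (1 - b) *: (g *: p + (1 - g) *: q) + (1 - (1 - b)) *: z.
  have -> : y = m + (b *: w + f *: d) by rewrite -yE addrC subrK.
  rewrite /w /d /m /g; case: (p) (q) (z) => [p1 p2] [q1 q2] [z1 z2].
  by congr pair; rewrite /= /GRing.scale /=; field.
have gb : g * (1 - b) = (1 - b) * a - f by rewrite divfK.
apply: convex_comb => //; last lra.
by apply: convex_comb => //; rewrite ler_pdivlMr ?ler_pdivrMr; nra.
Unshelve. all: by end_near. Qed.

Lemma boundaryE C p : closed C -> boundary C p <-> C p /\ ~ nbhs p C.
Proof. by move=> cC; rewrite /boundary -(closure_id C).1. Qed.

(** Two triangles on either side of the line cover a neighbourhood of the
    middle point [q], which is therefore interior. *)
Lemma collinear_boundary C u p q z y y' : convex_set (M := (R * R)%type) C ->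
  closed C -> dot p u = dot q u -> dot z u = dot q u ->
  dot p (perp u) < dot q (perp u) -> dot q (perp u) < dot z (perp u) ->
  C p -> C z -> C y -> C y' -> dot y u < dot q u -> dot q u < dot y' u ->
  ~ boundary C q.
Proof.
move=> cC clC pu zu pq qz Cp Cz Cy Cy' yu y'u /(boundaryE _ clC)[_]; apply.
have uu : u != 0.
  by apply/eqP => u0; move: yu; rewrite u0 /dot /= !mulr0 addr0 ltxx.
have ru : perp u != 0.
  by apply/eqP => u0; move: pq; rewrite u0 /dot /= !mulr0 addr0 ltxx.
pose a := (dot z (perp u) - dot q (perp u)) / (dot z (perp u) - dot p (perp u)).
have D : 0 < dot z (perp u) - dot p (perp u) by lra.
have a01 : 0 < a < 1 by rewrite divr_gt0//= ?ltr_pdivrMr//; lra.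
have pz : p != z by apply: contraTneq qz => <-; rewrite -leNgt ltW.
have qE : q = a *: p + (1 - a) *: z.
  apply: (@eq_dot_orthogonal (perp u) u) => //.
  - by rewrite /dot /perp /=; ring.
  - by rewrite dotDl !dotZl /a; field; rewrite gt_eqF.
  - by rewrite dotDl !dotZl pu zu; ring.
have h1 := @near_triangle C p z y' u a cC Cp Cz Cy' pz a01.
have h2 := @near_triangle C p z y (- u) a cC Cp Cz Cy pz a01.
rewrite !dotNr -qE in h1 h2.
have {}h1 : \forall x \near q, 0 <= dot (x - q) u -> C x.
  by apply: h1; lra.
have {}h2 : \forall x \near q, 0 <= dot (x - q) (- u) -> C x.
  by apply: h2; lra.
apply: filterS2 h1 h2 => x; rewrite dotNr oppr_ge0.
by case: (leP 0 (dot (x - q) u)) => [_ /(_ isT)//|/ltW xq _ /(_ xq)].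
Qed.

(** Of three points on a line, one lies between the two others. *)
Lemma boundary_line C u p q z y y' : convex_set (M := (R * R)%type) C ->
  closed C -> boundary C p -> boundary C q -> boundary C z ->
  p != q -> q != z -> p != z ->
  dot p u = dot q u -> dot z u = dot q u ->
  C y -> C y' -> dot y u < dot q u -> dot q u < dot y' u -> False.
Proof.
move=> cC clC bp bq bz pq qz pz pu zu Cy Cy' yu y'u.
have [Cp _] := (boundaryE p clC).1 bp; have [Cq _] := (boundaryE q clC).1 bq.
have [Cz _] := (boundaryE z clC).1 bz.
have uu : u != 0.
  by apply/eqP => u0; move: yu; rewrite u0 /dot /= !mulr0 addr0 ltxx.
have ru : perp u != 0.
  apply: contra_neq uu; case: (u) => a b [/eqP]; rewrite oppr_eq0 => /eqP-> /= ->.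
  by [].
have neq v w : v != w -> dot v u = dot w u -> dot v (perp u) != dot w (perp u).
  move=> vw e; apply: contra_neq vw => e'.
  by apply: (@eq_dot_orthogonal (perp u) u) => //; rewrite /dot /perp /=; ring.
have {}pq := neq _ _ pq pu; have {}qz := neq _ _ qz (esym zu).
have {neq}pz : dot p (perp u) != dot z (perp u) by apply: neq => //; rewrite pu.
have col := @collinear_boundary C u.
move: pq qz pz; rewrite !neq_lt.
case/orP => h1; case/orP => h2; case/orP => h3; try lra.
- by apply: (col p q z y y') => //; lra.
- by apply: (col p z q y y') => //; lra.
- by apply: (col z p q y y') => //; lra.
- by apply: (col q p z y y') => //; lra.
- by apply: (col q z p y y') => //; lra.
- by apply: (col z q p y y') => //; lra.
Qed.

(** * Arc length parametrizations *)

Definition Lip1 gamma l :=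
  forall a b, 0 <= a -> a <= b -> b <= l -> enorm (gamma b - gamma a) <= b - a.

Lemma arc_length_Lip1 C l gamma : arc_length_param C l gamma -> Lip1 gamma l.
Proof.
move=> [_ _ _ _ len] a b a0; rewrite le_eqVlt => /predU1P[->|ab] bl.
  by rewrite !subrr enorm0.
rewrite -lee_fin -(len a b a0 (ltW ab) bl).
apply: ereal_sup_ubound => /=; exists [:: b]; first exact: itv_partition1.
by rewrite /polygonal_length /= big_nat1.
Qed.

(** Partitions are replaced by monotone sequences of parameters, over which sums
    telescope. *)
Lemma arc_length_le C l gamma a b (W : R) : arc_length_param C l gamma ->
  0 <= a -> a <= b -> b <= l ->
  (forall n (s : nat -> R), (forall k, (k < n)%N -> s k <= s k.+1) ->
     (forall k, (k <= n)%N -> a <= s k <= b) -> s 0%N = a -> s n = b ->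
     \sum_(k < n) enorm (gamma (s k.+1) - gamma (s k)) <= W) ->
  b - a <= W.
Proof.
move=> [_ _ _ _ len] a0 ab bl h.
rewrite -lee_fin -(len a b a0 ab bl); apply: ge_ereal_sup => _ [t tab <-].
rewrite lee_fin /polygonal_length /= big_mkord; apply: h => //.
- move=> k kt; apply: ltW; case: tab => + _.
  by move=> /(pathP b) /(_ k kt).
- move=> k kt; rewrite (itv_partition_nth_ge _ tab)//.
  by rewrite (itv_partition_nth_le _ tab).
- exact: itv_partition_nth_size tab.
Qed.

Lemma lipschitz_within f l (K : R) :
  (forall x y, 0 <= x -> x <= y -> y <= l -> `|f y - f x| <= K * (y - x)) ->
  {within `[0, l], continuous (f : R -> R)}.
Proof.
move=> fK; apply/subspace_continuousP => x /=; rewrite in_itv/= => /andP[x0 xl].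
have K0 : 0 < `|K| + 1 by rewrite ltr_wpDl.
apply/cvgrPdist_lt => e e0.
have d0 : 0 < e / (`|K| + 1) by rewrite divr_gt0.
rewrite near_withinE; near=> y => /=; rewrite in_itv/= => /andP[y0 yl].
have xy : `|x - y| < e / (`|K| + 1).
  by near: y; apply: nbhsx_ballx.
rewrite ltr_pdivlMr// mulrC in xy; apply: le_lt_trans xy.
apply: (@le_trans _ _ (K * `|x - y|)).
  have [xy|/ltW yx] := leP x y.
    by rewrite distrC [`|x - y|]distrC [`|y - x|]ger0_norm ?subr_ge0//; exact: fK.
  by rewrite [`|x - y|]ger0_norm ?subr_ge0//; exact: fK.
by rewrite ler_wpM2r//; have := ler_norm K; lra.
Unshelve. all: by end_near. Qed.

Lemma Lip1_dot gamma l u : Lip1 gamma l ->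
  forall x y, 0 <= x -> x <= y -> y <= l ->
    `|dot (gamma y) u - dot (gamma x) u| <= enorm u * (y - x).
Proof.
move=> lip x y x0 xy yl; rewrite -dotBl; apply: le_trans (normr_dot_le _ _) _.
by rewrite mulrC ler_wpM2l ?enorm_ge0//; exact: lip.
Qed.

(** The levels of [dot _ u] are lines, and a line that has points of [C] on both
    sides meets the boundary at most twice. *)
Lemma convex_two_turns C l gamma u : compact C ->
  convex_set (M := (R * R)%type) C -> arc_length_param C l gamma ->
  exists m M, two_turns (fun s => dot (gamma s) u) l m M.
Proof.
move=> kC cC gC; have lip := arc_length_Lip1 gC; case: gC => l0 _ inj im _.
have clC : closed C by apply: compact_closed => //; exact: norm_hausdorff.
have bd x : 0 <= x <= l -> boundary C (gamma x).
  by move=> xl; rewrite -im; exists x => //=; rewrite in_itv.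
apply: two_turns_of_levels; first exact: ltW.
  by apply: (@lipschitz_within _ l (enorm u)); exact: Lip1_dot.
move=> x y z t x0 xy yz zl <- fy fz [w wl fw] [v vl fv].
have neq a b : 0 < a -> a < b -> b < l -> gamma a != gamma b.
  move=> a0 ab bl; apply/eqP => e.
  by have : a = b; [apply: inj => //; rewrite in_itv/=; lra|lra].
apply: (@boundary_line C u (gamma y) (gamma x) (gamma z) (gamma w) (gamma v)) => //.
- by apply: bd; lra.
- by apply: bd; lra.
- by apply: bd; lra.
- by rewrite eq_sym neq//; lra.
- by apply: neq; lra.
- by apply: neq; lra.
- by have [] := (boundaryE _ clC).1 (bd _ wl).
- by have [] := (boundaryE _ clC).1 (bd _ vl).
Qed.

End convex_curves.

(** * Tangents of a convex curve *)

Section tangents.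
Context {R : realType}.
Implicit Types (C : set (R * R)) (p q u v w z : R * R) (gamma : R -> R * R) (x y : R).

Lemma polar p : exists x, (0 <= x <= pi *+ 2) /\ p = enorm p *: dir x.
Proof.
have [p0|p0] := eqVneq (enorm p) 0.
  exists 0; rewrite lexx mulrn_wge0 ?pi_ge0//; split => //.
  by rewrite p0 scale0r; exact: enorm_eq0.
have [|x /andP[x0 /ltW x2] e] := @unit_dir _ ((enorm p)^-1 *: p).
  by rewrite enormZ ger0_norm ?invr_ge0 ?enorm_ge0// mulVf.
by exists x; rewrite x0 x2; split => //; rewrite -e scalerA divff// scale1r.
Qed.

Lemma dot_perpE d p : enorm d = 1 ->
  dot p p = dot p d ^+ 2 + dot p (perp d) ^+ 2.
Proof.
move=> d1; have : dot d d = 1 by rewrite -sqr_enorm d1 expr1n.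
move=> dd; rewrite -[LHS]mulr1 -dd /dot /perp /=; ring.
Qed.

Lemma enorm_le_dot d p : enorm d = 1 ->
  enorm p <= `|dot p d| + `|dot p (perp d)|.
Proof.
move=> d1; apply: enorm_le; first by rewrite addr_ge0.
rewrite (dot_perpE _ d1) [leRHS]sqrrD !real_normK ?num_real//.
by have : 0 <= `|dot p d| * `|dot p (perp d)| by []; lra.
Qed.

Section curve.
Variables (C : set (R * R)) (gamma : R -> R * R) (l : R).
Hypothesis gC : arc_length_param C l gamma.
Hypothesis turns : forall u, exists m M, two_turns (fun s => dot (gamma s) u) l m M.

(** The direction of the curve after time [x]: a cluster point of the directions
    of the chords from [gamma x]. Monotonicity in each direction [u] makes a
    positive [dot d u] at the cluster point decide the sense of variation. *)
Lemma right_direction x : 0 <= x -> x < l -> exists2 d, enorm d = 1 &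
  forall u, 0 < dot d u ->
    exists2 y, x < y <= l & ndecr (fun s => dot (gamma s) u) x y.
Proof.
move=> x0 xl; have [l0 _ inj _ _] := gC.
have /choice[phi phiP] : forall h, exists t, (0 <= t <= pi *+ 2) /\
    gamma (x + h) - gamma x = enorm (gamma (x + h) - gamma x) *: dir t.
  by move=> h; exact: polar.
(* The angles of the chords lie in a compact interval. *)
have [t [_ tcl]] :
    `[0, pi *+ 2]%classic `&` cluster (phi h @[h --> 0^'+]) !=set0.
  apply: (@segment_compact R 0 (pi *+ 2)).
  by apply: (@filterE _ 0^'+) => h; rewrite /= in_itv/=; have [] := phiP h.
exists (dir t); first exact: enorm_dir.
move=> u tu; have [m [M tt]] := turns u.
have [y /andP[xy yl] [?|dec]] := two_turns_right_monotone tt x0 xl.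
  by exists y => //; rewrite xy.
have neg : \forall h \near 0^'+, dot (dir (phi h)) u <= 0.
  have d0 : 0 < y - x by rewrite subr_gt0.
  near=> h.
  have h0 : 0 < h by [].
  have hy : h < y - x by near: h; exact: nbhs_right_lt.
  have := dec x (x + h) (lexx _); rewrite lerDl => /(_ (ltW h0)).
  have -> : x + h <= y by lra.
  move=> /(_ isT); rewrite lerN2 -subr_le0 -dotBl (phiP h).2 dotZl.
  rewrite pmulr_rle0// lt_neqAle enorm_ge0 andbT eq_sym.
  apply/eqP => /enorm_eq0/eqP; rewrite subr_eq0 => /eqP e.
  have : x + h = x by apply: inj => //; rewrite in_itv/=; lra.
  lra.
have pos : nbhs t [set a | 0 < dot (dir a) u].
  have : open ((fun a => dot u (dir a)) @^-1` [set a | 0 < a]).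
    by apply: open_comp; [move=> a _; exact: continuous_dot_dir|exact: open_gt].
  rewrite openE => /(_ t); rewrite /= dotC => /(_ tu); apply: filterS => a /=.
  by rewrite dotC.
have [a /= [a0 a1]] := tcl [set a | dot (dir a) u <= 0] _ neg pos.
by rewrite leNgt a1 in a0.
Unshelve. all: by end_near. Qed.

(** The curve rises in the two directions [perp d + e *: d] and
    [- perp d + e *: d], which squeezes its chords towards [d]. *)
Lemma right_cone x : 0 <= x -> x < l -> exists2 d, enorm d = 1 &
  forall e, 0 < e -> exists2 y, x < y <= l &
    forall s t, x <= s -> s <= t -> t <= y ->
      `|dot (gamma t - gamma s) (perp d)| <= e * dot (gamma t - gamma s) d.
Proof.
move=> x0 xl; have [d d1 dP] := right_direction x0 xl; exists d => // e e0.
have dd : dot d d = 1 by rewrite -sqr_enorm d1 expr1n.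
have dr : dot d (perp d) = 0 by rewrite /dot /perp /=; ring.
have [|y /andP[xy yl] yP] := dP (perp d + e *: d).
  by rewrite dotDr dotZr dd dr; lra.
have [|z /andP[xz zl] zP] := dP (- perp d + e *: d).
  by rewrite dotDr dotNr dotZr dd dr; lra.
exists (Num.min y z); first by rewrite lt_min ge_min xy xz yl.
move=> s t xs st; rewrite le_min => /andP[ty tz].
have h1 : 0 <= dot (gamma t - gamma s) (perp d + e *: d).
  by rewrite dotBl subr_ge0; exact: yP.
have h2 : 0 <= dot (gamma t - gamma s) (- perp d + e *: d).
  by rewrite dotBl subr_ge0; exact: zP.
rewrite [dot _ (_ + _)]dotDr dotZr in h1.
rewrite [dot _ (_ + _)]dotDr dotNr dotZr in h2.
by rewrite ler_norml; lra.
Qed.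

(** In a thin cone around [d] the length of a curve is nearly its progress along
    [d]; as the curve has unit speed, [d] is its right derivative. *)
Lemma right_tangent x : 0 <= x -> x < l -> exists2 d, enorm d = 1 &
  forall e, 0 < e -> exists2 y, x < y <= l &
    forall t, x < t -> t <= y ->
      enorm ((t - x)^-1 *: (gamma t - gamma x) - d) <= e.
Proof.
move=> x0 xl; have [d d1 dP] := right_cone x0 xl; exists d => // e e0.
have dd : dot d d = 1 by rewrite -sqr_enorm d1 expr1n.
have dr : dot d (perp d) = 0 by rewrite /dot /perp /=; ring.
have e2 : 0 < e / 2 by rewrite divr_gt0.
have [y xyl yP] := dP (e / 2) e2; exists y => // t xt ty.
have cone s s' : x <= s -> s <= s' -> s' <= t ->
    enorm (gamma s' - gamma s) <= (1 + e / 2) * dot (gamma s' - gamma s) d.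
  move=> xs ss st; have h := yP s s' xs ss (le_trans st ty).
  have : 0 <= dot (gamma s' - gamma s) d.
    by rewrite -(pmulr_rge0 _ e2); exact: le_trans h.
  by move=> h'; apply: le_trans (enorm_le_dot _ d1) _; rewrite (ger0_norm h'); lra.
have tx : 0 < t - x by rewrite subr_gt0.
(* Length against progress along [d]: each polygon stays in the cone. *)
have upper : t - x <= (1 + e / 2) * dot (gamma t - gamma x) d.
  apply: (arc_length_le gC x0); [exact: ltW|lra|] => n s sn sx s0 sn'.
  apply: (@le_trans _ _ (\sum_(k < n)
      (1 + e / 2) * (dot (gamma (s k.+1)) d - dot (gamma (s k)) d))).
    apply: ler_sum => -[k kn] _ /=; rewrite -dotBl; apply: cone.
    - by have := sx k (ltnW kn); lra.
    - exact: sn.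
    - by have := sx k.+1 kn; lra.
  rewrite -mulr_sumr -(big_mkord xpredT
    (fun k => dot (gamma (s k.+1)) d - dot (gamma (s k)) d)).
  by rewrite (telescope_sumr (fun k => dot (gamma (s k)) d))// s0 sn' dotBl.
have lower : dot (gamma t - gamma x) d <= t - x.
  apply: le_trans (dot_le _ _) _; rewrite d1 mulr1.
  by apply: (arc_length_Lip1 gC) => //; lra.
have side := yP x t (lexx _) (ltW xt) ty.
apply: le_trans (enorm_le_dot _ d1) _.
rewrite !dotBl !dotZl dd dr subr0 [leRHS]splitr.
set A := dot _ d in upper lower side *; set B := dot _ (perp d) in side *.
have i0 : 0 < (t - x)^-1 by rewrite invr_gt0.
have a1 : (t - x)^-1 * A <= 1 by rewrite mulrC ler_pdivrMr// mul1r.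
have a2 : 1 <= (1 + e / 2) * ((t - x)^-1 * A).
  by rewrite mulrCA mulrC ler_pdivlMr// mul1r.
have a3 : e / 2 * ((t - x)^-1 * A) <= e / 2 by rewrite ler_piMr// ltW.
apply: lerD; first by rewrite ler_norml; lra.
rewrite normrM gtr0_norm//; apply: le_trans a3.
by rewrite mulrCA ler_pM2l.
Qed.


Lemma unit_tangentP x : 0 <= x -> x < l -> enorm (unit_tangent gamma x) = 1 /\
  forall e, 0 < e -> exists2 y, x < y <= l &
    forall t, x < t -> t <= y ->
      enorm ((t - x)^-1 *: (gamma t - gamma x) - unit_tangent gamma x) <= e.
Proof.
move=> x0 xl; have [d d1 dP] := right_tangent x0 xl.
suff -> : unit_tangent gamma x = d by [].
suff cv : (h^-1 *: (gamma (x + h) - gamma x) @[h --> 0^'+]) --> d.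
  by apply: (cvg_lim _ cv); exact: norm_hausdorff.
apply/cvgrPdist_le => e e0; have [y /andP[xy yl] yP] := dP e e0.
near=> h.
have h0 : 0 < h by [].
have hy : h < y - x by near: h; apply: nbhs_right_lt; rewrite subr_gt0.
have := yP (x + h); rewrite ltrDl h0 => /(_ isT).
have -> : x + h <= y by lra.
have -> : x + h - x = h by ring.
move=> /(_ isT).
rewrite distrC; apply: le_trans.
set v := _ - d.
by rewrite [`|v|]prod_normE ge_max normr_fst_le normr_snd_le.
Unshelve. all: by end_near. Qed.

Lemma unit_tangent_ge0 u x y : 0 <= x -> x < y -> y <= l ->
  ndecr (fun s => dot (gamma s) u) x y -> 0 <= dot (unit_tangent gamma x) u.
Proof.
move=> x0 xy yl up; have [_ tP] := unit_tangentP x0 (lt_le_trans xy yl).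
rewrite leNgt; apply/negP => neg.
set T := unit_tangent gamma x in tP neg *.
have u0 : 0 < 1 + enorm u by rewrite ltr_wpDr ?enorm_ge0.
pose e := - dot T u / 2 / (1 + enorm u).
have e0 : 0 < e by rewrite !divr_gt0// oppr_gt0.
have [z /andP[xz zl] zP] := tP e e0.
pose t := Num.min y z.
have xt : x < t by rewrite lt_min xy.
have /zP-/(_ _)/= := xt; rewrite ge_min lexx orbT => /(_ isT) te.
have h1 : 0 <= dot ((t - x)^-1 *: (gamma t - gamma x)) u.
  rewrite dotZl mulr_ge0 ?invr_ge0 ?subr_ge0 ?(ltW xt)// dotBl subr_ge0.
  by apply: up => //; [exact: ltW|rewrite ge_min lexx].
have : - dot T u <= e * (1 + enorm u).
  apply: (@le_trans _ _ (dot ((t - x)^-1 *: (gamma t - gamma x) - T) u)).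
    by rewrite dotBl; lra.
  apply: le_trans (dot_le _ _) _; apply: ler_pM => //; rewrite ?enorm_ge0//.
  by rewrite lerDr.
by rewrite divfK ?gt_eqF//; lra.
Qed.

(** The sign of [dot T u] tells whether the curve rises in the direction [u];
    it changes at most twice. *)
Lemma unit_tangent_turning n (s : nat -> R) :
  (forall k, (k < n)%N -> s k <= s k.+1) ->
  (forall k, (k <= n)%N -> 0 <= s k < l) ->
  \sum_(k < n) enorm (unit_tangent gamma (s k.+1) - unit_tangent gamma (s k))
    <= 2 * pi.
Proof.
move=> sn sl; apply: (@turning_le R n (unit_tangent gamma \o s)).
  by move=> k kn; have /andP[x0 xl] := sl k kn; have [] := unit_tangentP x0 xl.
move=> phi; have [m [M tt]] := turns (dir phi).
apply: (two_turns_sign_changes (e := fun x => dot (unit_tangent gamma x) (dir phi))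
  tt _ _ sn sl).
  by move=> x y x0 xy yl; exact: unit_tangent_ge0.
move=> x y x0 xy yl down; rewrite -oppr_ge0 -dotNr.
apply: (unit_tangent_ge0 x0 xy yl) => a b xa ab ay.
by rewrite !dotNr; exact: down.
Qed.

End curve.
End tangents.

(** * Perimeter of convex sets in a disk *)

Section perimeter.
Context {R : realType}.
Implicit Types (C : set (R * R)) (p q u v w z : R * R) (gamma : R -> R * R) (x y : R).

Lemma continuous_enormB p : continuous (fun q => enorm (q - p)).
Proof.
move=> q; apply/cvgrPdist_lt => e e0.
have e2 : 0 < e / 2 by rewrite divr_gt0.
near=> z.
have h : `|z - q| < e / 2.
  by rewrite distrC; near: z; apply: (@cvgr_dist_lt _ _ _ (nbhs q)) => //; exact: cvg_id.
rewrite prod_normE gt_max in h; move/andP: h => [h1 h2].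
apply: (@le_lt_trans _ _ (enorm (z - q))); last first.
  by apply: le_lt_trans (enorm_le_sum _) _; rewrite [e]splitr ltrD.
rewrite ler_norml.
have := enormD (z - q) (q - p); have := enormD (q - z) (z - p).
rewrite [enorm (q - z)]enormC !addrA !subrK; lra.
Unshelve. all: by end_near. Qed.

(** The line through the point of [C] nearest to [p], orthogonal to the segment
    that joins them, leaves [C] on one side; this keeps the support function of
    [C] below the radius in one direction. *)
Lemma convex_separation C c r p : compact C ->
  convex_set (M := (R * R)%type) C -> C !=set0 -> disk c r p -> ~ C p ->
  exists n (d : R), [/\ enorm n = 1, 0 < d &
    forall q, C q -> dot (q - c) n <= r - d].
Proof.
move=> kC cC C0 pr Cp.
have [q /set_mem Cq qmin] := @compact_EVT_min _ _ (fun q => enorm (q - p)) C C0 kC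
  (continuous_subspaceT (@continuous_enormB p)).
have {}qmin z : C z -> enorm (q - p) <= enorm (z - p).
  by move=> Cz; apply: qmin; rewrite inE.
pose d := enorm (p - q).
have d0 : 0 < d.
  rewrite lt_neqAle enorm_ge0 andbT eq_sym; apply/eqP => /enorm_eq0/eqP.
  by rewrite subr_eq0 => /eqP e; apply: Cp; rewrite e.
have obtuse z : C z -> dot (z - q) (p - q) <= 0.
  move=> Cz; rewrite leNgt; apply/negP => pos.
  pose A := dot (z - q) (p - q); pose B := dot (z - q) (z - q).
  have A0 : 0 < A by [].
  have BE : 0 <= B by rewrite /B -sqr_enorm sqr_ge0.
  have B0 : 0 < B + A + 1 by lra.
  (* A small step from [q] towards [z] would come closer to [p]. *)
  pose t := A / (B + A + 1).
  have t0 : 0 < t by rewrite divr_gt0.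
  have t1 : t <= 1 by rewrite ler_pdivrMr//; lra.
  have tB : t * (B + A + 1) = A by rewrite divfK ?gt_eqF.
  have := qmin (t *: z + (1 - t) *: q).
  move=> /(_ (convex_comb cC Cz Cq _)); rewrite t1 (ltW t0) => /(_ isT).
  rewrite -(@ler_pXn2r _ 2) ?nnegrE ?enorm_ge0// !sqr_enorm.
  have -> : dot (t *: z + (1 - t) *: q - p) (t *: z + (1 - t) *: q - p) =
      dot (q - p) (q - p) - t * (2 * A - t * B).
    by rewrite /A /B; case: (z) (q) (p) => [z1 z2] [q1 q2] [p1 p2];
      rewrite /dot /= /GRing.scale /=; ring.
  have : 0 < t * (2 * A - t * B) by rewrite mulr_gt0//; nra.
  lra.
exists (d^-1 *: (p - q)), d; split => //.
  by rewrite enormZ ger0_norm ?invr_ge0 ?enorm_ge0// mulVf ?gt_eqF.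
move=> z Cz.
have h1 : dot (z - q) (d^-1 *: (p - q)) <= 0.
  by rewrite dotZr pmulr_rle0 ?invr_gt0//; exact: obtuse.
have h2 : dot (p - q) (d^-1 *: (p - q)) = d.
  by rewrite dotZr -sqr_enorm -/d expr2 mulKf ?gt_eqF.
have h3 : dot (p - c) (d^-1 *: (p - q)) <= r.
  apply: le_trans (dot_le _ _) _.
  by rewrite enormZ ger0_norm ?invr_ge0 ?enorm_ge0// mulVf ?gt_eqF// mulr1.
move: h1 h2 h3; rewrite !dotBl; lra.
Qed.

Lemma unit_dir_half p : enorm p = 1 ->
  exists (s : bool) x, 0 <= x < pi /\ p = (-1) ^+ s *: dir x.
Proof.
move=> /unit_dir[x /andP[x0 x2] ->].
have [xpi|pix] := ltP x pi.
  by exists false, x; rewrite x0 xpi expr0 scale1r.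
exists true, (x - pi); split; first by rewrite mulr2n in x2; lra.
rewrite expr1 scaleN1r -[RHS]/(- cos _, - sin _) (cosB _ pi) (sinB _ pi).
by rewrite cospi sinpi /dir; congr pair; ring.
Qed.

Section curve.
Variables (C : set (R * R)) (gamma : R -> R * R) (l : R) (c : R * R) (r : R).
Hypothesis r0 : 0 < r.
Hypothesis kC : compact C.
Hypothesis cC : convex_set (M := (R * R)%type) C.
Hypothesis Cr : C `<=` disk c r.
Hypothesis gC : arc_length_param C l gamma.

Let curve_in x : 0 <= x <= l -> C (gamma x).
Proof.
move=> xl; have [_ _ _ im _] := gC.
have clC : closed C by apply: compact_closed => //; exact: norm_hausdorff.
have : boundary C (gamma x) by rewrite -im; exists x => //=; rewrite in_itv.
by case/(boundaryE _ clC).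
Qed.

(** By Cauchy's formula the length is a multiple of the mean variation of the
    projections, each of which is at most twice the width of [C]. *)
Lemma arc_length_le_width h a b : 0 <= h -> a <= b -> `[a, b] `<=` `[0, pi] ->
  (forall x p q, x \in `[a, b] -> C p -> C q ->
     dot (p - q) (dir x) <= 2 * r - h) ->
  l <= 2 * pi * r - h * (b - a).
Proof.
move=> h0 ab abpi hab; have [l0 gl _ _ _] := gC.
rewrite -[l in l <= _]subr0.
apply: (arc_length_le gC) => //; first exact: ltW.
move=> n s sn sl _ _.
have width x W : (forall p q, C p -> C q -> dot (p - q) (dir x) <= W) ->
    \sum_(k < n) `|dot (gamma (s k.+1) - gamma (s k)) (dir x)| <= 2 * W.
  move=> CW; have [m [M tt]] := convex_two_turns (dir x) kC cC gC.
  under eq_bigr do rewrite dotBl.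
  apply: (two_turns_variation tt) => //; first by rewrite gl.
  by move=> y z yl zl; rewrite -dotBl; apply: CW; exact: curve_in.
have := @polygon_length_le R n (gamma \o s) (4 * r) (2 * h) a b _ ab abpi.
rewrite mulr_ge0// => /(_ isT _ _) poly.
have : 2 * \sum_(k < n) enorm (gamma (s k.+1) - gamma (s k)) <=
    4 * r * pi - 2 * h * (b - a).
  apply: poly => x => [|xab].
    apply: (le_trans (width x (2 * r) _)); last lra.
    move=> p q /Cr Cp /Cr Cq; apply: le_trans (dot_le _ _) _.
    rewrite enorm_dir mulr1 -(subrKA c).
    apply: le_trans (enormD _ _) _.
    by rewrite [enorm (c - q)]enormC [leRHS]mulrDl mul1r lerD.
  by apply: (le_trans (width x (2 * r - h) _)); [move=> p q; exact: hab|lra].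
by lra.
Qed.

Lemma perimeter_le : l <= 2 * pi * r.
Proof.
have := @arc_length_le_width 0 0 0 (lexx _) (lexx _); rewrite mul0r !subr0; apply.
  by move=> x /=; rewrite !in_itv/= => /andP[x0 x0']; have := pi_gt0 R; lra.
move=> x p q _ /Cr Cp /Cr Cq; apply: le_trans (dot_le _ _) _.
rewrite enorm_dir mulr1 -(subrKA c).
apply: le_trans (enormD _ _) _.
by rewrite [enorm (c - q)]enormC [leRHS]mulrDl mul1r lerD.
Qed.

(** The width of [C] across a line that separates [p] from [C], and in the
    neighbouring directions, is smaller than the diameter of the disk. *)
Lemma perimeter_lt p : disk c r p -> ~ C p -> l < 2 * pi * r.
Proof.
move=> pr Cp; have [l0 _ _ _ _] := gC.
have C0 : C !=set0 by exists (gamma 0); apply: curve_in; rewrite lexx ltW.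
have [n [d [/unit_dir_half[s [x [/andP[x0 xpi] ->]]] d0 nP]]] :=
  convex_separation kC cC C0 pr Cp.
(* Directions within [e] of the separating one lose at most half of the gap
   [d]; the bound [pi - x] keeps them in [[0, pi]]. *)
pose e := Num.min (pi - x) (d / 2 / r).
have e0 : 0 < e by rewrite lt_min subr_gt0 xpi !divr_gt0.
have er : e * r <= d / 2 by rewrite -ler_pdivlMr// ge_min lexx orbT.
have ex : e <= pi - x by rewrite ge_min lexx.
have d2 : 0 <= d / 2 by rewrite divr_ge0// ltW.
have side y q : x <= y <= x + e -> C q ->
    dot (q - c) ((-1) ^+ s *: dir y) <= r - d / 2.
  move=> xy Cq; have -> : (-1) ^+ s *: dir y =
      (-1) ^+ s *: dir x + (-1) ^+ s *: (dir y - dir x).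
    by rewrite -scalerDr addrC subrK.
  rewrite dotDr; have := nP q Cq.
  suff : dot (q - c) ((-1) ^+ s *: (dir y - dir x)) <= d / 2 by lra.
  apply: le_trans (dot_le _ _) _; rewrite enormZ normr_sign mul1r mulrC.
  apply: le_trans er; apply: ler_pM; rewrite ?enorm_ge0//; last exact: Cr.
  by apply: le_trans (enorm_dirB_le _ _) _; rewrite ger0_norm; lra.
have := @arc_length_le_width (d / 2) x (x + e) d2.
rewrite lerDl (ltW e0) => /(_ isT) h.
apply: (le_lt_trans (h _ _)).
- by move=> y /=; rewrite !in_itv/=; lra.
- move=> y p1 p2; rewrite in_itv/= => xy Cp1 Cp2.
  have wide q : C q -> `|dot (q - c) (dir y)| <= r.
    move=> /Cr Cq; apply: le_trans (normr_dot_le _ _) _.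
    by rewrite enorm_dir mulr1.
  have := side y p1 xy Cp1; have := side y p2 xy Cp2.
  have := wide p1 Cp1; have := wide p2 Cp2.
  rewrite !ler_norml !dotZr !dotBl; case: s {nP side}; rewrite ?expr0 ?expr1; lra.
have : 0 < d / 2 * (x + e - x) by rewrite mulr_gt0 ?divr_gt0//; lra.
by lra.
Qed.

End curve.
End perimeter.

(** * Comparison of integrals *)

Section integral_comparison.
Context d (T : measurableType d) (R : realType) (mu : {measure set T -> \bar R}).
Import HBNNSimple.
Local Open Scope ereal_scope.

(** The integral of a nonnegative function is the supremum of the integrals of
    the simple functions below it. In this form the comparison applies to the
    curvature, which is given by a limit that may fail to exist. *)
Lemma le_integral_off_negligible (D N : set T) (f g : T -> \bar R) :
  measurable D -> measurable N -> mu N = 0 ->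
  (forall x, D x -> 0 <= f x) -> (forall x, D x -> 0 <= g x) ->
  measurable_fun D g -> (forall x, D x -> ~ N x -> f x <= g x) ->
  \int[mu]_(x in D) f x <= \int[mu]_(x in D) g x.
Proof.
move=> mD mN N0 f0 g0 mg fg; rewrite (ge0_integralE _ f0).
apply: ge_ereal_sup => _ [h /= hf <-].
have -> : sintegral mu h = \int[mu]_(x in D) (h x)%:E.
  rewrite integral_nnsfun//; congr (sintegral mu _).
  apply/funext => x; rewrite /patch; case: ifPn => // /negP xD.
  apply/eqP; rewrite eq_le; apply/andP; split; last exact: fun_ge0.
  rewrite -lee_fin; apply: le_trans (hf x) _; rewrite /patch.
  by case: ifPn => // /xD.
apply: (@ae_ge0_le_integral _ _ _ mu D mD (fun x => (h x)%:E) g) => //.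
- by move=> x _; rewrite lee_fin.
- exact/measurable_EFinP/measurable_funTS.
exists N; split => // x /=; apply: contra_notP => xN Dx.
apply: le_trans (fg x Dx xN); apply: le_trans (hf x) _.
by rewrite /patch mem_set.
Qed.

Lemma cst_mul_le_integral (D E : set T) (k : R) (f : T -> \bar R) :
  measurable E -> E `<=` D -> (0 <= k)%R ->
  (forall x, D x -> 0 <= f x) -> (forall x, E x -> k%:E <= f x) ->
  k%:E * mu E <= \int[mu]_(x in D) f x.
Proof.
move=> mE ED k0 f0 kf; rewrite (ge0_integralE _ f0).
apply: ereal_sup_ubound => /=.
exists (scale_nnsfun (indic_nnsfun R mE) k0).
  move=> x /=; rewrite -[mindic R mE x]/(\1_E x) /patch indicE.
  case: ifPn => [/set_mem Dx|/negP xD].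
    case: (boolP (x \in E)) => [/set_mem Ex|_]; first by rewrite mulr1 kf.
    by rewrite mulr0 f0.
  case: (boolP (x \in E)) => [/set_mem/ED/mem_set/xD//|_].
  by rewrite mulr0.
by rewrite sintegralrM sintegral_indic.
Qed.

End integral_comparison.

(** * Total curvature *)

Section total_curvature.
Context {R : realType}.
Local Notation mu := (@lebesgue_measure R).

Lemma limn_einf_ge (u : (\bar R)^nat) (a : \bar R) :
  (\forall n \near \oo, (a <= u n)%E) -> (a <= limn_einf u)%E.
Proof.
move=> [N _ au]; rewrite limn_einf_lim; apply: lime_ge; first exact: is_cvg_einfs.
near=> n; apply: le_ereal_inf_tmp => _ [k /= nk <-]; apply: au => /=.
by apply: leq_trans nk; near: n; exact: nbhs_infty_ge.
Unshelve. all: by end_near. Qed.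

Variables (T : R -> R * R) (l W : R).
Hypothesis l0 : 0 < l.
Hypothesis turning : forall n (s : nat -> R),
  (forall k, (k < n)%N -> s k <= s k.+1) ->
  (forall k, (k <= n)%N -> 0 <= s k < l) ->
  \sum_(k < n) enorm (T (s k.+1) - T (s k)) <= W.

Let mesh n : R := l / n.+1%:R.
Let node n k : R := k%:R * mesh n.

(** The last interval of the subdivision is left out, [T] being unconstrained
    at [l]. *)
Let slope n (s : R) : \bar R :=
  (\sum_(k < n) (enorm (T (node n k.+1) - T (node n k)) / mesh n)%:E *
     (\1_`[node n k, node n k.+1[ s)%:E)%E.

Let mesh_gt0 n : 0 < mesh n. Proof. by rewrite divr_gt0. Qed.

Let node_le n k : node n k <= node n k.+1.
Proof. by rewrite ler_pM2r// ler_nat. Qed.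

Let node_in n k : (k <= n)%N -> 0 <= node n k < l.
Proof.
move=> kn; rewrite mulr_ge0//= ?(ltW (mesh_gt0 n))// /node /mesh mulrA.
by rewrite ltr_pdivrMr// mulrC ltr_pM2l// ltr_nat ltnS.
Qed.

Let measurable_slope n (D : set R) : measurable_fun D (slope n).
Proof.
apply: emeasurable_sum => k; apply: measurable_funeM.
by apply/measurable_EFinP; exact: measurable_indic.
Qed.

Let slope_ge0 n s : (0 <= slope n s)%E.
Proof.
apply: sume_ge0 => k _; rewrite -EFinM lee_fin mulr_ge0//.
by rewrite divr_ge0 ?enorm_ge0// ltW.
Qed.

Let integral_slope n : (\int[mu]_(s in `[0%R, l]) slope n s <= W%:E)%E.
Proof.
rewrite (@ge0_integral_sum _ _ _ mu _ (measurable_itv _) _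
  (fun (k : 'I_n) (s : R) =>
    (enorm (T (node n k.+1) - T (node n k)) / mesh n)%:E *
     (\1_`[node n k, node n k.+1[ s)%:E)%E); last 2 first.
- move=> k; apply: measurable_funeM.
  by apply/measurable_EFinP; exact: measurable_indic.
- move=> k s _; rewrite -EFinM lee_fin mulr_ge0//.
  by rewrite divr_ge0 ?enorm_ge0// ltW.
have W1 := @turning n (node n) (fun k _ => node_le n k) (@node_in n).
apply: (@le_trans _ _ (\sum_(k < n) enorm (T (node n k.+1) - T (node n k)))%:E); last first.
  by rewrite lee_fin.
rewrite -sumEFin; apply: lee_sum => -[k kn] _ /=.
have e0 : 0 <= enorm (T (node n k.+1) - T (node n k)) / mesh n.
  by rewrite divr_ge0 ?enorm_ge0// ltW.
rewrite ge0_integralZl_EFin//; last first.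
  by apply/measurable_EFinP; exact: measurable_indic.
rewrite integral_indic//.
apply: (@le_trans _ _ ((enorm (T (node n k.+1) - T (node n k)) / mesh n)%:E *
    (mesh n)%:E)%E); last by rewrite -EFinM divfK ?gt_eqF.
rewrite lee_wpmul2l ?lee_fin//.
apply: (@le_trans _ _ (mu `[node n k, node n k.+1[)).
  by apply: le_measure; rewrite ?inE//; exact: measurableI.
rewrite lebesgue_measure_itv/= lte_fin ltr_pM2r// ltr_nat ltnSn.
by rewrite -EFinB lee_fin /node -mulrBl -natr1 addrAC subrr add0r mul1r.
Qed.

(** At a point of differentiability, difference quotients between two points
    that straddle it converge to the derivative. At the other points the limit
    that defines [derive1] takes the default value [0]. *)
Let slope_ge s : 0 < s -> s < l ->
  ((enorm (derive1 T s))%:E <= limn_einf (slope^~ s))%E.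
Proof.
move=> s0 sl; have [cv|ncv] := pselect (cvg (h^-1 *: (T (h + s) - T s) @[h --> 0^'])); last first.
  rewrite /derive1 dvgP// -[enorm _]/(enorm (0 : R * R)) enorm0.
  apply: limn_einf_ge; exact: nearW.
move: cv; rewrite -/(derive1 T s); set v := derive1 T s => cv.
apply/lee_addgt0Pr => e e0.
have e2 : 0 < e / 2 by rewrite divr_gt0.
have [h h0 hT] : exists2 h, 0 < h & forall t, `|t - s| < h ->
    enorm (T t - T s - (t - s) *: v) <= e * `|t - s|.
  have /cvgrPdist_le/(_ _ e2) : (h^-1 *: (T (h + s) - T s) @[h --> 0^']) --> v.
    exact: cv.
  move=> /nbhs_ballP[h /= h0 hP]; exists h => // t ts.
  have [->|ts0] := eqVneq t s.
    by rewrite !subrr scale0r subr0 enorm0 normr0 mulr0.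
  have t0 : t - s != 0 by rewrite subr_eq0.
  have := hP (t - s); rewrite /ball/= sub0r normrN => /(_ ts t0).
  rewrite subrK => hv.
  have -> : T t - T s - (t - s) *: v = (t - s) *: ((t - s)^-1 *: (T t - T s) - v).
    by rewrite scalerBr scalerA divff// scale1r.
  rewrite enormZ mulrC ler_wpM2r// enormC.
  apply: le_trans (enorm_le_sum _) _; rewrite [e]splitr.
  by apply: lerD; apply: le_trans hv; rewrite prod_normE le_max lexx ?orbT.
pose m := Num.min h (l - s).
have m0 : 0 < m by rewrite lt_min h0 subr_gt0.
rewrite -leeBlDr//; apply: limn_einf_ge; exists (Num.truncn (l / m)) => // n /= mn.
(* With a mesh below [m], both nodes around [s] are close to [s] and the right
   one is not the last. *)
have mesh_lt : mesh n < m.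
  rewrite ltr_pdivrMr// mulrC -ltr_pdivrMr//.
  by apply: lt_le_trans (Num.Theory.truncnS_gt _) _; rewrite ler_nat ltnS.
have [mesh_h mesh_l] : mesh n < h /\ mesh n < l - s.
  by move: mesh_lt; rewrite lt_min => /andP.
pose k := Num.truncn (s / mesh n).
have /andP[k1 k2] : k%:R <= s / mesh n < k.+1%:R.
  by apply: Num.Theory.truncn_itv; rewrite divr_ge0// ltW.
have a_le : node n k <= s by rewrite -ler_pdivlMr.
have b_gt : s < node n k.+1 by rewrite -ltr_pdivrMr.
have ba : node n k.+1 - node n k = mesh n.
  by rewrite /node -mulrBl -natr1 addrAC subrr add0r mul1r.
have kn : (k < n)%N.
  rewrite -(ltr_nat R); apply: le_lt_trans k1 _; rewrite ltr_pdivrMr//.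
  have : mesh n * n.+1%:R = l by rewrite divfK.
  by rewrite -natr1 mulrDr mulr1 mulrC; lra.
rewrite /slope (bigD1 (Ordinal kn))//= indicE mem_set/=; last first.
  by rewrite in_itv/= a_le b_gt.
rewrite mule1; apply: (@le_trans _ _
    (enorm (T (node n k.+1) - T (node n k)) / mesh n)%:E); last first.
  rewrite leeDl// sume_ge0// => j _; rewrite -EFinM lee_fin mulr_ge0//.
  by rewrite divr_ge0 ?enorm_ge0// ltW.
rewrite -EFinB lee_fin ler_pdivlMr//.
set a := node n k in a_le ba *; set b := node n k.+1 in b_gt ba *.
have hb : enorm (T b - T s - (b - s) *: v) <= e * (b - s).
  by have := hT b; rewrite gtr0_norm ?subr_gt0//; apply; lra.
have ha : enorm (T a - T s - (a - s) *: v) <= e * (s - a).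
  by have := hT a; rewrite distrC ger0_norm ?subr_ge0//; apply; lra.
have : enorm ((b - a) *: v) <= enorm (T b - T a) +
    (enorm (T b - T s - (b - s) *: v) + enorm (T a - T s - (a - s) *: v)).
  rewrite -[enorm (T b - T s - _)]enormN.
  apply: le_trans (lerD (lexx _) (enormD _ _)); apply: le_trans (enormD _ _).
  rewrite le_eqVlt; apply/orP; left; apply/eqP; congr euclidean_norm.
  move: (T a) (T b) (T s) v {cv hT ha hb} => [? ?] [? ?] [? ?] [? ?].
  by congr pair; rewrite /= /GRing.scale /=; ring.
rewrite enormZ ger0_norm; last by rewrite subr_ge0; lra.
have -> : (enorm v - e) * mesh n = (b - a) * enorm v - e * (b - a).
  by rewrite ba; ring.
lra.
Qed.

(** Fatou's lemma for the slopes, which integrate to the lengths of polygons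
    inscribed in the curve of tangents. *)
Lemma total_curvature_le : exists g : R -> \bar R,
  [/\ measurable_fun `[0, l] g, forall s, (0 <= g s)%E,
      (\int[mu]_(s in `[0%R, l]) g s <= W%:E)%E &
      forall s, 0 < s -> s < l -> ((enorm (derive1 T s))%:E <= g s)%E].
Proof.
exists (fun s => limn_einf (slope^~ s)); split.
- rewrite (_ : (fun s => _) = (fun s => - limn_esup (-%E \o slope^~ s))%E).
    apply: measurableT_comp => //; apply: measurable_fun_limn_esup => n.
    by apply: measurableT_comp => //; exact: measurable_slope.
  by apply/funext => s; rewrite limn_esupN oppeK.
- by move=> s; apply: limn_einf_ge; exact: nearW.
- have fat := @fatou _ _ _ mu _ (measurable_itv `[0, l]) slope
    (fun n => @measurable_slope n _) (fun n x _ => slope_ge0 n x).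
  apply: (le_trans fat).
  rewrite limn_einf_lim; apply: lime_le; first exact: is_cvg_einfs.
  apply: nearW => n; apply: le_trans (integral_slope n).
  by apply: ereal_inf_lbound; exists n => /=.
- exact: slope_ge.
Qed.

End total_curvature.

(** * Affine perimeter *)

Section affine_bound.
Context {R : realType}.
Local Notation mu := (@lebesgue_measure R).
Implicit Types (x r : R).

(** Arithmetic-geometric inequality for [r * x], [1] and [1]; equality holds at
    the curvature [x = r^-1] of the circle. *)
Lemma powR3V_le x r : 0 < r -> 0 <= x ->
  x `^ 3^-1 <= r^-1 `^ 3^-1 / 3 * (r * x + 2).
Proof.
move=> r0 x0; set y := (r * x) `^ 3^-1.
have rx : 0 <= r * x by rewrite mulr_ge0// ltW.
have y3 : y ^+ 3 = r * x.
  by rewrite -powR_mulrn ?powR_ge0// -powRrM mulVf ?powRr1// pnatr_eq0.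
have -> : x `^ 3^-1 = r^-1 `^ 3^-1 * y.
  by rewrite -powRM ?invr_ge0// ?(ltW r0)// mulrA mulVf ?gt_eqF// mul1r.
rewrite -y3 -mulrA ler_wpM2l ?powR_ge0//.
have y0 : 0 <= y by exact: powR_ge0.
have : 0 <= (y - 1) ^+ 2 * (y + 2) by rewrite mulr_ge0 ?sqr_ge0// addr_ge0.
have -> : (y - 1) ^+ 2 * (y + 2) = y ^+ 3 + 2 - 3 * y by ring.
by lra.
Qed.

(** The pointwise bound is affine in the curvature, so that it integrates to a
    combination of the total curvature, at most [2 * pi], and of the length. *)
Lemma param_affine_perimeter_le C c r l gamma : 0 < r -> compact C ->
  convex_set (M := (R * R)%type) C -> C `<=` disk c r ->
  arc_length_param C l gamma ->
  (param_affine_perimeter l gamma <=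
     (r^-1 `^ 3^-1 / 3 * (2 * pi * r + 2 * l))%:E)%E.
Proof.
move=> r0 kC cC Cr gC; have [l0 _ _ _ _] := gC.
have turns u := convex_two_turns u kC cC gC.
have [g [mg g0 gW gP]] := total_curvature_le l0 (unit_tangent_turning gC turns).
set k := r^-1 `^ 3^-1 / 3.
have k0 : 0 <= k by rewrite divr_ge0// powR_ge0.
have mG : measurable_fun `[0, l] (fun s => k%:E * (r%:E * g s + 2%:E))%E.
  apply: measurable_funeM; apply: emeasurable_funD => //.
  exact: measurable_funeM.
apply: (@le_trans _ _ (\int[mu]_(s in `[0%R, l]) (k%:E * (r%:E * g s + 2%:E)))%E).
  apply: (@le_integral_off_negligible _ _ _ mu `[0, l] [set 0; l]) => //.
  - exact: measurableU.
  - by rewrite measureU0 ?(lebesgue_measure_set1 0)//; exact: lebesgue_measure_set1.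
  - by move=> s _; rewrite lee_fin powR_ge0.
  - move=> s _; rewrite mule_ge0// adde_ge0// mule_ge0//.
    by rewrite lee_fin ltW.
  move=> s /=; rewrite in_itv/= => /andP[s0 sl] /not_orP[/eqP s0' /eqP sl'].
  have {s0 s0'} s0 : 0 < s by rewrite lt_neqAle eq_sym s0'.
  have {sl sl'} sl : s < l by rewrite lt_neqAle sl'.
  have ks := gP s s0 sl.
  apply: (@le_trans _ _ (k * (r * curvature gamma s + 2))%:E).
    by rewrite lee_fin; apply: powR3V_le => //; exact: enorm_ge0.
  rewrite EFinM EFinD; apply: lee_wpmul2l; first by rewrite lee_fin.
  apply: leeD => //; rewrite EFinM; apply: lee_wpmul2l => //.
  by rewrite lee_fin ltW.
have r0' : (0 <= r%:E)%E by rewrite lee_fin ltW.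
rewrite ge0_integralZl_EFin//; last 2 first.
- by move=> s _; rewrite adde_ge0// mule_ge0.
- by apply: emeasurable_funD => //; exact: measurable_funeM.
rewrite ge0_integralD//; last 2 first.
- by move=> s _; rewrite mule_ge0.
- exact: measurable_funeM.
rewrite ge0_integralZl_EFin//.
rewrite -[X in (_ + X)%E]/(\int[mu]_(s in `[0%R, l]) (cst 2%:E s))%E.
rewrite integral_cst//= lebesgue_measure_itv/= lte_fin l0 oppr0 adde0.
rewrite [leRHS]EFinM; apply: lee_wpmul2l; first by rewrite lee_fin.
rewrite [leRHS]EFinD [(2 * l)%:E]EFinM.

apply: leeD => //; rewrite [leRHS](_ : _ = r%:E * (2 * pi)%:E)%E.
  exact: lee_wpmul2l.
by rewrite -EFinM; congr EFin; ring.
Qed.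

End affine_bound.

(** * Second order expansions of the circle *)

Section circle.
Context {R : realType}.
Implicit Types (p q u v w c : R * R) (gamma : R -> R * R) (x y h r s t : R).

Lemma normr_sinB_le h : `|h| <= 1 -> `|sin h - h| <= h ^+ 2 / 2.
Proof.
wlog h0 : h / 0 < h.
  move=> H; have [/H//|h0|<-] := ltgtP 0 h; last by rewrite sin0 subrr normr0 expr0n mul0r.
  by have := H (- h); rewrite oppr_gt0 normrN sqrrN sinN -opprD normrN; apply.
rewrite gtr0_norm// => h1.
have [|c ch] := @MVT R sin cos 0 h h0 (fun y _ => is_derive_sin y).
  by apply: continuous_subspaceT => y; exact: continuous_sin.
rewrite sin0 !subr0 => ->; rewrite in_itv/= in ch.
have := two_subr_cos_le c; have := cos_le1 c => c1 c2.
have -> : cos c * h - h = - ((1 - cos c) * h) by ring.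
rewrite normrN ger0_norm; last by rewrite mulr_ge0 ?subr_ge0// ltW; lra.
have : (1 - cos c) * h <= c ^+ 2 / 2 * h by rewrite ler_wpM2r; lra.
have : c ^+ 2 / 2 * h <= h ^+ 2 / 2.
  rewrite mulrAC ler_pM2r ?invr_gt0//.
  apply: (@le_trans _ _ (c ^+ 2)); first by rewrite ler_piMr ?sqr_ge0.
  by apply: lerXn2r; rewrite ?nnegrE; lra.
lra.
Qed.

Lemma dirD x y : dir (x + y) = cos y *: dir x + sin y *: perp (dir x).
Proof. by rewrite /dir cosD sinD; congr pair; rewrite /= /GRing.scale /=; ring. Qed.

Lemma enorm_perp v : enorm (perp v) = enorm v.
Proof. by rewrite /euclidean_norm /= sqrrN addrC. Qed.

Lemma dir_expansion x h : `|h| <= 1 ->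
  enorm (dir (x + h) - dir x - h *: perp (dir x)) <= h ^+ 2.
Proof.
move=> h1; have -> : dir (x + h) - dir x - h *: perp (dir x) =
    (cos h - 1) *: dir x + (sin h - h) *: perp (dir x).
  by rewrite dirD !scalerBl scale1r [RHS]addrACA [RHS]addrA.
apply: le_trans (enormD _ _) _; rewrite !enormZ.
rewrite enorm_perp enorm_dir !mulr1.
have := normr_sinB_le h1; have := two_subr_cos_le h; have := cos_le1 h => a b d.
have : `|cos h - 1| <= h ^+ 2 / 2 by rewrite ler0_norm; lra.
lra.
Qed.

Lemma dir_chord x h : 0 <= h <= 1 ->
  h - h ^+ 2 / 2 <= enorm (dir (x + h) - dir x).
Proof.
move=> /andP[h0 h1]; apply: (@le_trans _ _ (sin h)).
  have := @normr_sinB_le h; rewrite ger0_norm// => /(_ h1).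
  by rewrite ler_norml; lra.
have <- : dot (dir (x + h) - dir x) (perp (dir x)) = sin h.
  rewrite dirD dotBl dotDl !dotZl.
  have -> : dot (dir x) (perp (dir x)) = 0 by rewrite /dot /perp /=; ring.
  have -> : dot (perp (dir x)) (perp (dir x)) = 1.
    by rewrite -(cos2Dsin2 x) /dot /perp /=; ring.
  ring.
apply: le_trans (dot_le _ _) _.
by rewrite enorm_perp enorm_dir mulr1.
Qed.

Lemma cos_lt1 x : 0 < x < pi *+ 2 -> cos x < 1.
Proof.
move=> hx; have s0 : 0 < sin (x / 2).
  by apply: sin_gt0_pi; rewrite mulr2n in hx; lra.
by have := exprn_gt0 2 s0; rewrite (cos_double x); lra.
Qed.

Lemma cvg_slope (V : normedModType R) (f : R -> V) x (v : V) (K d : R) : 0 < d ->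
  (forall h, 0 < `|h| -> `|h| < d -> `|f (x + h) - f x - h *: v| <= K * h ^+ 2) ->
  (h^-1 *: (f (x + h) - f x) @[h --> 0^']) --> v.
Proof.
move=> d0 fK; apply/cvgrPdist_le => e e0.
have K0 : 0 < `|K| + 1 by rewrite ltr_wpDl.
near=> h.
have h0 : h != 0 by near: h; exact: nbhs_dnbhs_neq.
have hd : `|h| < d.
  near: h; apply: dnbhs0_lt => //.
have he : `|h| < e / (`|K| + 1).
  by near: h; apply: dnbhs0_lt; rewrite divr_gt0.
have hK := fK h; rewrite normr_gt0 h0 hd in hK; have {}hK := hK isT isT.
rewrite distrC; have -> : h^-1 *: (f (x + h) - f x) - v =
    h^-1 *: (f (x + h) - f x - h *: v).
  by rewrite [RHS]scalerBr scalerA mulVf// scale1r.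
rewrite normrZ normfV mulrC ler_pdivrMr ?normr_gt0//.
apply: le_trans hK _.
rewrite ltr_pdivlMr// in he.
have -> : h ^+ 2 = `|h| ^+ 2 by rewrite real_normK ?num_real.
have := ler_norm K; have : 0 <= `|h| by []; nra.
Unshelve. all: by end_near. Qed.

Lemma is_derive_quadratic (f : R -> R) x a (K d : R) : 0 < d ->
  (forall h, 0 < `|h| -> `|h| < d -> `|f (x + h) - f x - h * a| <= K * h ^+ 2) ->
  is_derive x 1 f a.
Proof.
move=> d0 fK; have cv := @cvg_slope _ f x a K d d0 fK.
have {}cv : (h^-1 *: (f (h *: 1 + x) - f x) @[h --> 0^']) --> a.
  rewrite (_ : (fun h => _) = fun h => h^-1 *: (f (x + h) - f x))//.
  by apply/funext => h; rewrite [h *: 1]mulr1 [h + x]addrC.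
apply: DeriveDef; first by apply/cvg_ex; exists a.
by apply: (cvg_lim _ cv); exact: norm_hausdorff.
Qed.

Lemma prod_norm_le_enorm p : `|p| <= enorm p.
Proof. by rewrite prod_normE ge_max normr_fst_le normr_snd_le. Qed.

Lemma derive1_quadratic gamma x v (K d : R) : 0 < d ->
  (forall h, 0 < `|h| -> `|h| < d ->
     enorm (gamma (x + h) - gamma x - h *: v) <= K * h ^+ 2) ->
  derive1 gamma x = v.
Proof.
move=> d0 gK.
have cv : (h^-1 *: (gamma (h + x) - gamma x) @[h --> 0^']) --> v.
  under eq_fun do rewrite [_ + x]addrC.
  apply: (@cvg_slope _ gamma x v K d d0) => h h0 hd.
  by apply: le_trans (prod_norm_le_enorm _) _; exact: gK.
by apply: (cvg_lim _ cv); exact: norm_hausdorff.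
Qed.

Lemma unit_tangent_quadratic gamma x v (K d : R) : 0 < d ->
  (forall h, 0 < `|h| -> `|h| < d ->
     enorm (gamma (x + h) - gamma x - h *: v) <= K * h ^+ 2) ->
  unit_tangent gamma x = v.
Proof.
move=> d0 gK.
have cv : (h^-1 *: (gamma (x + h) - gamma x) @[h --> 0^'+]) --> v.
  apply: cvg_dnbhs_at_right.
  apply: (@cvg_slope _ gamma x v K d d0) => h h0 hd.
  by apply: le_trans (prod_norm_le_enorm _) _; exact: gK.
by apply: (cvg_lim _ cv); exact: norm_hausdorff.
Qed.

(** The tangent is itself a uniform rotation, on the unit circle. *)
Lemma curvature_rotation gamma l c r A (e : R) : 0 < r -> e ^+ 2 = 1 ->
  (forall t, 0 < t -> t < l -> gamma t = c + r *: dir (A + e * (t / r))) ->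
  forall s, 0 < s -> s < l -> curvature gamma s = r^-1.
Proof.
move=> r0 e1 gE.
have en : `|e| = 1.
  apply/eqP; rewrite -(@eqrXn2 _ 2)// expr1n real_normK ?num_real//; exact/eqP.
have near_in s h : 0 < s -> s < l -> `|h| < Num.min (Num.min s (l - s)) r ->
    [/\ 0 < s + h, s + h < l & `|e * (h / r)| <= 1].
  move=> s0 sl; rewrite !lt_min => /andP[/andP[hs hl] hr].
  move: hs hl; rewrite !ltr_norml => hs hl; split; [lra|lra|].
  by rewrite normrM en mul1r normrM normfV (gtr0_norm r0) ler_pdivrMr// mul1r ltW.
have d0 s : 0 < s -> s < l -> 0 < Num.min (Num.min s (l - s)) r.
  by move=> s0 sl; rewrite !lt_min s0 subr_gt0 sl r0.
have shift s h : A + e * ((s + h) / r) = A + e * (s / r) + e * (h / r).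
  by rewrite mulrDl mulrDr addrA.
have sq h : (e * (h / r)) ^+ 2 = r ^- 2 * h ^+ 2.
  by rewrite exprMn e1 mul1r exprMn exprVn mulrC.
have tangent s : 0 < s -> s < l ->
    unit_tangent gamma s = e *: perp (dir (A + e * (s / r))).
  move=> s0 sl; apply: (@unit_tangent_quadratic _ _ _ (r * r ^- 2) _ (d0 s s0 sl)).
  move=> h _ /(near_in s h s0 sl)[sh0 shl h1].
  rewrite !gE// shift.
  set x := A + e * (s / r).
  have -> : c + r *: dir (x + e * (h / r)) - (c + r *: dir x) - h *: (e *: perp (dir x)) =
     r *: (dir (x + e * (h / r)) - dir x - (e * (h / r)) *: perp (dir x)).
    rewrite [in RHS]scalerBr [in RHS]scalerBr scalerA scalerA opprD addrACA subrr add0r.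
    by congr (_ - _ *: _); field; rewrite gt_eqF.
  rewrite enormZ gtr0_norm// -mulrA ler_pM2l// -sq.
  exact: dir_expansion.
move=> s s0 sl; rewrite /curvature.
rewrite (@derive1_quadratic _ s (- r^-1 *: dir (A + e * (s / r))) (r ^- 2) _ (d0 s s0 sl)).
  by rewrite enormZ enorm_dir mulr1 normrN gtr0_norm ?invr_gt0.
move=> h _ /(near_in s h s0 sl)[sh0 shl h1]; rewrite !tangent// shift.
set x := A + e * (s / r).
have -> : e *: perp (dir (x + e * (h / r))) - e *: perp (dir x) - h *: (- r^-1 *: dir x) =
   e *: perp (dir (x + e * (h / r)) - dir x - (e * (h / r)) *: perp (dir x)).
  have -> : h *: (- r^-1 *: dir x) = (e * (e * (h / r))) *: (- dir x).
    by rewrite scalerA scalerN -scaleNr mulrN [e * _]mulrA -expr2 e1 mul1r.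
  by rewrite /perp; congr pair; rewrite /= /GRing.scale /=; ring.
rewrite enormZ en mul1r -sq.
by rewrite enorm_perp; exact: dir_expansion.
Qed.

End circle.

(** * The circle as a uniform rotation *)

Section circle_param.
Context {R : realType}.
Implicit Types (p q u v w c : R * R) (gamma : R -> R * R) (x y h s t : R).

Lemma closed_disk c (r : R) : closed (disk c r).
Proof.
apply: (@preimage_closed _ _ (fun p => enorm (p - c)) [set x | x <= r]).
  by move=> p _; exact: continuous_enormB.
exact: closed_le.
Qed.

Lemma boundary_disk c (r : R) p : 0 < r ->
  boundary (disk c r) p <-> enorm (p - c) = r.
Proof.
move=> r0; apply: (iff_trans (boundaryE _ (@closed_disk c r))); split.
  rewrite /disk /= => -[pr pint]; apply/eqP; rewrite eq_le pr /= leNgt.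
  apply/negP => lt; apply: pint.
  have : open ((fun p => enorm (p - c)) @^-1` [set x | x < r]).
    by apply: open_comp; [move=> q _; exact: continuous_enormB|exact: open_lt].
  rewrite openE => /(_ p lt); apply: filterS => q /=; exact: ltW.
move=> pr; split; first by rewrite /disk /= pr.
move=> /nbhs_ballP[e /= e0 pe].
have e2r : 0 < e / 2 / r by rewrite !divr_gt0.
have /pe : ball p e (p + (e / 2 / r) *: (p - c)).
  rewrite prod_norm_ball /ball_ /= opprD addNKr normrN.
  apply: le_lt_trans (prod_norm_le_enorm _) _.
  by rewrite enormZ pr gtr0_norm// divfK ?gt_eqF//; lra.
rewrite /disk /= addrAC -{1}[p - c]scale1r -scalerDl enormZ pr.
rewrite gtr0_norm ?addr_gt0// mulrDl mul1r divfK ?gt_eqF//; lra.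
Qed.

Lemma dir_inj x y : 0 <= x < pi *+ 2 -> 0 <= y < pi *+ 2 -> dir x = dir y -> x = y.
Proof.
wlog xy : x y / x <= y.
  move=> H; have [|/ltW] := leP x y; first exact: H.
  by move=> yx hx hy /esym /(H _ _ yx hy hx).
move=> hx hy e; have c1 : cos (y - x) = 1.
  by rewrite -dot_dir e -sqr_enorm enorm_dir expr1n.
move: xy; rewrite le_eqVlt => /predU1P[//|xy].
have : cos (y - x) < 1 by apply: cos_lt1; lra.
by rewrite c1 ltxx.
Qed.

Lemma curve_length_ge gamma a b n (s : nat -> R) :
  (forall k, (k < n)%N -> s k < s k.+1) -> s 0%N = a -> s n = b ->
  ((\sum_(k < n) enorm (gamma (s k.+1) - gamma (s k)))%:E <=
    curve_length a b gamma)%E.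
Proof.
move=> sn s0 snb; pose t := mkseq (fun k => s k.+1) n.
have tE k : (k <= n)%N -> nth b (a :: t) k = s k.
  by case: k => [|k] kn /=; [rewrite s0|rewrite nth_mkseq].
apply: ereal_sup_ubound; exists t.
  split; last first.
    by rewrite (last_nth b) size_mkseq tE// snb.
  apply/(pathP b) => k; rewrite size_mkseq => kn.
  by rewrite nth_mkseq//; have := tE k (ltnW kn); rewrite /= => ->; exact: sn.
rewrite /polygonal_length size_mkseq big_mkord; congr (_%:E).
apply: eq_bigr => -[k kn] _ /=; rewrite nth_mkseq//.
by rewrite -[nth b (a :: _) k]/(nth b (a :: t) k) tE// ltnW.
Qed.

Lemma curve_length_le gamma a b (W : R -> R) :
  (forall x y, a <= x -> x <= y -> y <= b -> enorm (gamma y - gamma x) <= W y - W x) ->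
  (curve_length a b gamma <= (W b - W a)%:E)%E.
Proof.
move=> gW; apply: ge_ereal_sup => _ [t tab <-].
rewrite lee_fin /polygonal_length /=.
apply: (@le_trans _ _ (\sum_(0 <= n < size t)
    (W (nth b (a :: t) n.+1) - W (nth b (a :: t) n)))).
  apply: ler_sum_nat => k /andP[_ kt]; apply: gW.
  - by apply: (itv_partition_nth_ge _ tab); exact: leqW.
  - by apply: ltW; case: tab => + _; move=> /(pathP b) /(_ k kt).
  - exact: (@itv_partition_nth_le _ _ _ _ t k.+1 kt tab).
by rewrite (telescope_sumr (fun k => W (nth b (a :: t) k)))//=
  (itv_partition_nth_size _ tab).
Qed.

Section rotation.
Variables (c : R * R) (r : R).
Hypothesis r0 : 0 < r.

Definition rotation s : R * R := c + r *: dir (s / r).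

Lemma rotationB s t : rotation t - rotation s = r *: (dir (t / r) - dir (s / r)).
Proof. by rewrite /rotation opprD addrACA subrr add0r scalerBr. Qed.

Lemma rotation_Lip1 s t : s <= t -> enorm (rotation t - rotation s) <= t - s.
Proof.
move=> st; rewrite rotationB enormZ gtr0_norm// mulrC -ler_pdivlMr//.
apply: le_trans (enorm_dirB_le _ _) _.
by rewrite -mulrBl ger0_norm// divr_ge0 ?subr_ge0// ltW.
Qed.

Lemma rotation_chord s h : 0 <= h <= r ->
  h - h ^+ 2 / (2 * r) <= enorm (rotation (s + h) - rotation s).
Proof.
move=> /andP[h0 hr]; rewrite rotationB enormZ gtr0_norm//.
rewrite [(s + h) / r]mulrDl.
have -> : h - h ^+ 2 / (2 * r) = r * (h / r - (h / r) ^+ 2 / 2).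
  by field; rewrite gt_eqF.
by rewrite ler_pM2l//; apply: dir_chord; rewrite divr_ge0 ?ler_pdivrMr ?mul1r ?(ltW r0).
Qed.

(** Each of [n] equal chords is shorter than its arc by at most a term of order
    [n ^- 2], so that nothing is lost in the limit. *)
Lemma curve_length_rotation a b : a <= b ->
  curve_length a b rotation = (b - a)%:E.
Proof.
move=> ab; apply/eqP; rewrite eq_le; apply/andP; split.
  apply: (@curve_length_le _ _ _ id) => x y _ xy _; exact: rotation_Lip1.
move: ab; rewrite [a <= b]le_eqVlt => /predU1P[<-|ab].
  have := @curve_length_ge rotation a a 0 (fun=> a).
  by rewrite big_ord0 subrr; apply.
set L := b - a; have L0 : 0 < L by rewrite subr_gt0.
apply/lee_addgt0Pr => e e0.
pose n := Num.truncn (Num.max (L / r) (L ^+ 2 / (2 * r) / e)).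
have : Num.max (L / r) (L ^+ 2 / (2 * r) / e) < n.+1%:R.
  exact: Num.Theory.truncnS_gt.
rewrite gt_max => /andP[n1 n2].
pose h := L / n.+1%:R.
have h0 : 0 < h by rewrite divr_gt0.
have nh : n.+1%:R * h = L by rewrite mulrC divfK.
have hr : h <= r.
  by rewrite ler_pdivrMr// mulrC -ler_pdivrMr// ltW.
have sS k : a + k.+1%:R * h = a + k%:R * h + h by rewrite -natr1 mulrDl mul1r addrA.
have := @curve_length_ge rotation a b n.+1 (fun k => a + k%:R * h).
rewrite mul0r addr0 nh addrC subrK => /(_ _ erefl erefl) cl.
apply: le_trans (leeD2r _ (cl _)); last by move=> k _; rewrite sS ltrDl.
rewrite -EFinD lee_fin.
apply: (@le_trans _ _ (n.+1%:R * (h - h ^+ 2 / (2 * r)) + e)).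
  have -> : n.+1%:R * (h - h ^+ 2 / (2 * r)) = L - L ^+ 2 / (2 * r) / n.+1%:R.
    by rewrite -nh; field; rewrite (gt_eqF r0) andbT nat1r pnatr_eq0.
  have : L ^+ 2 / (2 * r) / n.+1%:R <= e.
    by rewrite ler_pdivrMr// [e * _]mulrC -ler_pdivrMr// ltW.
  by move=> ?; rewrite -addrA lerDl addrC subr_ge0.
rewrite lerD2r; have -> : n.+1%:R * (h - h ^+ 2 / (2 * r)) =
    \sum_(k < n.+1) (h - h ^+ 2 / (2 * r)).
  by rewrite sumr_const card_ord mulr_natl.
apply: ler_sum => k _; rewrite sS; apply: rotation_chord.
by rewrite ltW.
Qed.

Lemma arc_length_param_rotation :
  arc_length_param (disk c r) (2 * pi * r) rotation.
Proof.
have pi0 := pi_gt0 R.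
have l0 : 0 < 2 * pi * r by rewrite !mulr_gt0.
have e2 : 2 * pi * r / r = pi *+ 2 by rewrite mulfK ?gt_eqF// mulr2n; lra.
have in2 s : 0 <= s < 2 * pi * r -> 0 <= s / r < pi *+ 2.
  move=> /andP[s0 sl]; rewrite divr_ge0 ?(ltW r0)//= -e2 ltr_pM2r ?invr_gt0//.
split => //.
- by rewrite /rotation mul0r e2 /dir cos0 sin0 cos2pi sin2pi.
- move=> s t; rewrite !in_itv/= => /in2 hs /in2 ht e.
  have /eqP : dir (s / r) = dir (t / r).
    have := rotationB s t; rewrite e subrr => /esym/eqP.
    by rewrite scaler_eq0 gt_eqF//= subr_eq0 => /eqP.
  move=> /eqP /(dir_inj hs ht) /(congr1 ( *%R^~ r)).
  by rewrite !divfK ?gt_eqF.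
- apply/seteqP; split => p /=.
    move=> [s _ <-]; apply/(boundary_disk _ _ r0).
    by rewrite /rotation addrAC subrr add0r enormZ enorm_dir mulr1 gtr0_norm.
  move=> /(boundary_disk _ _ r0) pr.
  have [|x /andP[x0 x2] xE] := @unit_dir _ (r^-1 *: (p - c)).
    by rewrite enormZ pr gtr0_norm ?invr_gt0// mulVf ?gt_eqF.
  exists (x * r).
    rewrite in_itv/= mulr_ge0 ?(ltW r0)//= ler_pM2r//.
    by move: x2; rewrite mulr2n; lra.
  rewrite /rotation mulfK ?gt_eqF// -xE scalerA divff ?gt_eqF// scale1r.
  by rewrite addrC subrK.
- by move=> a b _ ab _; exact: curve_length_rotation.
Qed.

End rotation.
End circle_param.

(** * Arc length parametrizations of the circle *)

Section circle_unique.
Context {R : realType}.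
Implicit Types (p q u v w c : R * R) (gamma : R -> R * R) (x y h s t : R).

(** The quotient [y / (1 - x)] is the stereographic projection from [(1, 0)],
    which is the tangent of half an angle. *)
Lemma half_angle x y : x ^+ 2 + y ^+ 2 = 1 -> x < 1 ->
  let t := 2 * atan (y / (1 - x)) in cos t = - x /\ sin t = y.
Proof.
move=> xy x1; set T := y / (1 - x); set u := atan T.
have x1' : 1 - x != 0 by rewrite gt_eqF// subr_gt0.
have cu : cos u != 0.
  rewrite gt_eqF//; apply: cos_gt0_pihalf.
  by rewrite atan_gtNpi2 atan_ltpi2.
have su : sin u = T * cos u by rewrite -[T in RHS]atanK -/u /tan divfK.
have yT : y = T * (1 - x) by rewrite divfK.
have xT : 1 + x = T ^+ 2 * (1 - x).
  apply: (mulIf x1'); have -> : T ^+ 2 * (1 - x) * (1 - x) = y ^+ 2.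
    by rewrite yT; ring.
  by rewrite -[y ^+ 2](addKr (x ^+ 2)) xy; ring.
have c2 : cos u ^+ 2 * 2 = 1 - x.
  have := cos2Dsin2 u; rewrite su exprMn => e.
  have : (cos u ^+ 2 + T ^+ 2 * cos u ^+ 2) * (1 - x) = 1 - x by rewrite e mul1r.
  have -> : (cos u ^+ 2 + T ^+ 2 * cos u ^+ 2) * (1 - x) =
     cos u ^+ 2 * ((1 - x) + T ^+ 2 * (1 - x)) by ring.
  by rewrite -xT => <-; ring.
have -> : 2 * u = u + u by ring.
rewrite /= cosD sinD su; split.
  have -> : cos u * cos u - T * cos u * (T * cos u) =
     (cos u ^+ 2 * 2 - T ^+ 2 * (cos u ^+ 2 * 2)) / 2 by field.
  by rewrite c2 -xT; field.
have -> : T * cos u * cos u + cos u * (T * cos u) = T * (cos u ^+ 2 * 2) by ring.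
by rewrite c2 -yT.
Qed.

Section param.
Variables (c : R * R) (r l : R) (gamma : R -> R * R).
Hypothesis r0 : 0 < r.
Hypothesis gC : arc_length_param (disk c r) l gamma.

Let on_circle s : 0 <= s <= l -> enorm (gamma s - c) = r.
Proof.
move=> sl; have [_ _ _ im _] := gC; apply/(boundary_disk _ _ r0).
by rewrite -im; exists s => //=; rewrite in_itv.
Qed.

(** The point [gamma 0] is passed only once, so that the projection from it
    gives one continuous angle for the rest of the circle. *)
Lemma circle_angle : exists B (a : R -> R),
  [/\ {within `]0, l[, continuous a}, {in `]0, l[ &, injective a} &
      forall s, 0 < s -> s < l -> gamma s = c + r *: dir (B + a s)].
Proof.
have [l0 _ inj _ _] := gC.
have g0 : enorm (gamma 0 - c) = r by apply: on_circle; rewrite lexx ltW.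
have [|th _ thE] := @unit_dir _ (r^-1 *: (gamma 0 - c)).
  by rewrite enormZ g0 gtr0_norm ?invr_gt0// mulVf ?gt_eqF.
have g0E : gamma 0 - c = r *: dir th.
  by rewrite -thE scalerA divff ?gt_eqF// scale1r.
pose d := dir th.
have dd : enorm d = 1 by exact: enorm_dir.
pose X s := dot (gamma s - c) d / r; pose Y s := dot (gamma s - c) (perp d) / r.
have XY s : 0 <= s <= l -> X s ^+ 2 + Y s ^+ 2 = 1.
  move=> /on_circle gs; rewrite !exprMn -mulrDl -dot_perpE// -sqr_enorm gs.
  by rewrite -exprMn divff ?expr1n// gt_eqF.
have gE s : gamma s - c = r *: (X s *: d + Y s *: perp d).
  have e : dot d d = 1 by rewrite -sqr_enorm dd expr1n.
  rewrite /X /Y; move: (gamma s - c) => v.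
  rewrite scalerDr !scalerA ![r * (_ / r)]mulrC !divfK ?gt_eqF//.
  apply: (@eq_dot_orthogonal _ d (perp d)).
  - by apply/eqP => d0; move: e; rewrite d0 /dot /= !mulr0 addr0 => /esym/eqP;
      rewrite oner_eq0.
  - apply/eqP => d0; have := enorm_perp d; rewrite d0 dd enorm0 => /esym/eqP.
    by rewrite oner_eq0.
  - by rewrite /dot /perp /=; ring.
  - rewrite dotDl !dotZl e mulr1 [dot (perp d) d](_ : _ = 0) ?mulr0 ?addr0//.
    by rewrite /dot /perp /=; ring.
  - rewrite dotDl !dotZl [dot d (perp d)](_ : _ = 0) ?mulr0 ?add0r//.
      by rewrite -[dot (perp d) _]sqr_enorm enorm_perp dd expr1n mulr1.
    by rewrite /dot /perp /=; ring.
have X1 s : 0 < s -> s < l -> X s < 1.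
  move=> s0 sl; have xy := XY s; have {}xy : X s ^+ 2 + Y s ^+ 2 = 1 by apply: xy; lra.
  have := sqr_ge0 (Y s); rewrite lt_neqAle => y0; apply/andP; split; last by nra.
  apply/eqP => x1; have y00 : Y s = 0.
    by apply/eqP; rewrite -sqrf_eq0; apply/eqP; move: xy; rewrite x1; lra.
  have e : gamma s = gamma 0.
    apply/eqP; rewrite -subr_eq0 -(subrKA c) -[c - gamma 0]opprB g0E gE x1 y00.
    by rewrite scale1r scale0r addr0 subrr.
  have : s = 0 by apply: inj => //; rewrite in_itv/=; lra.
  lra.
pose a s := - (2 * atan (Y s / (1 - X s))).
have gaE s : 0 < s -> s < l -> gamma s = c + r *: dir (th + pi + a s).
  move=> s0 sl; have h : 0 <= s <= l by lra.
  have [ct st] := half_angle (XY s h) (X1 s s0 sl).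
  rewrite -[LHS](subrK c) addrC gE; congr (_ + _ *: _).
  rewrite /a; move: (2 * _) ct st => t ct st.
  rewrite -addrA dirD -/d (cosB pi) (sinB pi) cospi sinpi ct st.
  by congr (_ *: _ + _ *: _); ring.
have cont u : {within `]0, l[, continuous (fun s => dot (gamma s) u)}.
  apply: (@continuous_subspaceW _ _ _ `[0, l]).
    by move=> s /=; rewrite !in_itv/= => /andP[/ltW-> /ltW->].
  by apply: (@lipschitz_within _ _ l (enorm u)); exact: Lip1_dot (arc_length_Lip1 gC).
exists (th + pi), a; split => //.
- apply/subspace_continuousP => s sl.
  have [s0 sl'] : 0 < s /\ s < l by move: sl; rewrite /= in_itv/= => /andP.
  have cX u : (fun s => dot (gamma s - c) u / r) @ within `]0, l[%classic (nbhs s)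
      --> dot (gamma s - c) u / r.
    have /subspace_continuousP/(_ s sl) cu := cont u.
    apply: cvgM; last exact: cvg_cst.
    rewrite (_ : (fun s => _) = (fun s => dot (gamma s) u - dot c u)); last first.
      by apply/funext => t; rewrite dotBl.
    by rewrite dotBl; apply: cvgB => //; exact: cvg_cst.
  apply: cvgN; apply: cvgM; first exact: cvg_cst.
  apply: continuous_cvg; first exact: continuous_atan.
  apply: cvgM; first exact: cX.
  apply: cvgV; first by rewrite gt_eqF// subr_gt0 X1.
  by apply: cvgB; [exact: cvg_cst|exact: cX].
move=> s t hs ht e.
have [s0 sl] : 0 < s /\ s < l by move: hs; rewrite /= in_itv/= => /andP.
have [t0 tl] : 0 < t /\ t < l by move: ht; rewrite /= in_itv/= => /andP.
apply: inj; rewrite ?in_itv/=; [lra|lra|].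
by rewrite !gaE// e.
Qed.


(** The angle is injective, hence strictly monotone. Its increments are at least
    the arc lengths, because chords are at most as long as arcs, and they agree
    with them to second order, because the curve is 1-Lipschitz; therefore the
    angle grows at constant speed. The curve being closed, the total angle is at
    least one full turn. *)
Lemma circle_param_rotation : 2 * pi * r <= l /\
  exists A (e : R), e ^+ 2 = 1 /\
    forall t, 0 < t -> t < l -> gamma t = c + r *: dir (A + e * (t / r)).
Proof.
have [l0 g0l _ _ _] := gC; have lip := arc_length_Lip1 gC.
have [B [a [ca ia gE]]] := circle_angle.
have [e [e1 aup]] : exists e, e ^+ 2 = 1 /\ forall s t, 0 < s -> s < t -> t < l ->
    e * a s < e * a t.
  case: (itv_continuous_inj_mono ca ia) => mono; [exists 1|exists (-1)].
    rewrite expr1n; split => // s t s0 st tl; rewrite !mul1r.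
    by apply: mono => //; rewrite in_itv/=; lra.
  rewrite sqrrN expr1n; split => // s t s0 st tl; rewrite !mulN1r ltrN2.
  by apply: mono => //; rewrite in_itv/=; lra.
(* The signed arc length on the circle, oriented by [e] to be increasing. *)
pose G s := r * (e * a s).
have aG s : a s = e * (G s / r).
  by rewrite /G mulrAC divff ?gt_eqF// mul1r mulrA -expr2 e1 mul1r.
have ee : `|e| = 1.
  apply/eqP; rewrite -(@eqrXn2 _ 2)// expr1n real_normK ?num_real//; exact/eqP.
have eE : e = 1 \/ e = -1 by have := ee; case: (ltgtP e 0) => e0;
  [rewrite ltr0_norm//|rewrite gtr0_norm//|rewrite e0 normr0] => h; [right|left|right]; lra.
have Gup s t : 0 < s -> s < t -> t < l -> G s < G t.
  by move=> s0 st tl; rewrite ltr_pM2l// aup.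
have gG s t : 0 < s -> s < l -> 0 < t -> t < l ->
    gamma t - gamma s = r *: (dir (B + e * (G t / r)) - dir (B + e * (G s / r))).
  move=> s0 sl t0 tl; rewrite (gE t t0 tl) (gE s s0 sl) !aG.
  by rewrite opprD addrACA subrr add0r scalerBr.
have chord_le s t : 0 < s -> s <= t -> t < l ->
    enorm (gamma t - gamma s) <= G t - G s.
  move=> s0; rewrite le_eqVlt => /predU1P[->|st tl]; first by rewrite !subrr enorm0.
  rewrite gG//; try lra.
  rewrite enormZ gtr0_norm// mulrC -ler_pdivlMr//.
  apply: le_trans (enorm_dirB_le _ _) _.
  rewrite opprD addrACA subrr add0r -mulrBr normrM ee mul1r -mulrBl.
  by rewrite ger0_norm// divr_ge0 ?(ltW r0)// subr_ge0 ltW// Gup.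
have len s t : 0 < s -> s < t -> t < l -> t - s <= G t - G s.
  move=> s0 st tl; apply: (arc_length_le gC); [exact: ltW|exact: ltW|exact: ltW|].
  move=> n z zn zst z0 zt.
  apply: (@le_trans _ _ (\sum_(k < n) (G (z k.+1) - G (z k)))).
    apply: ler_sum => -[k kn] _ /=; apply: chord_le; last 1 first.
    - by have := zst k.+1 kn; lra.
    - by have := zst k (ltnW kn); lra.
    - exact: zn.
  rewrite -(big_mkord xpredT (fun k => G (z k.+1) - G (z k))).
  by rewrite (telescope_sumr (fun k => G (z k)))// z0 zt.
have chord_ge s t : 0 < s -> s < t -> t < l -> G t - G s <= r ->
    (G t - G s) - (G t - G s) ^+ 2 / (2 * r) <= t - s.
  move=> s0 st tl Gr; have Gst := Gup s t s0 st tl.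
  apply: le_trans (lip s t (ltW s0) (ltW st) (ltW tl)).
  rewrite gG//; try lra.
  rewrite enormZ gtr0_norm//.
  set h := (G t - G s) / r.
  have h01 : 0 <= h <= 1.
    by apply/andP; split; [apply: divr_ge0; lra|rewrite ler_pdivrMr// mul1r].
  have -> : (G t - G s) - (G t - G s) ^+ 2 / (2 * r) = r * (h - h ^+ 2 / 2).
    by rewrite /h; field; rewrite gt_eqF.
  rewrite ler_pM2l//; case: eE => ->.
    have -> : B + 1 * (G t / r) = B + 1 * (G s / r) + h by rewrite /h; ring.
    exact: dir_chord.
  rewrite enormC; have -> : B + -1 * (G s / r) = B + -1 * (G t / r) + h.
    by rewrite /h; ring.
  exact: dir_chord.
have quad s t : 0 < s -> s < t -> t < l -> G t - G s < r ->
    `|G t - G s - (t - s)| <= 2 / r * (t - s) ^+ 2.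
  move=> s0 st tl Gr; have L := len s t s0 st tl.
  have U := chord_ge s t s0 st tl (ltW Gr); have Gst := Gup s t s0 st tl.
  set D := G t - G s in L U Gr *; set h := t - s in L U *.
  have D0 : 0 < D by rewrite subr_gt0.
  have rr : r^-1 * r = 1 by rewrite mulVf ?gt_eqF.
  have q0 : D ^+ 2 / (2 * r) = D ^+ 2 * r^-1 / 2 by field; rewrite gt_eqF.
  have i0 : 0 < r^-1 by rewrite invr_gt0.
  have D2 : D <= 2 * h.
    have : D ^+ 2 * r^-1 <= D.
      by rewrite -[X in _ <= X]mulr1 expr2 -mulrA ler_pM2l// ler_pdivrMr// mul1r ltW.
    by rewrite q0 in U; lra.
  rewrite ger0_norm ?subr_ge0//.
  have : D ^+ 2 * r^-1 <= (2 * h) ^+ 2 * r^-1.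
    rewrite ler_pM2r//; apply: lerXn2r => //; rewrite nnegrE; lra.
  have -> : 2 / r * h ^+ 2 = (2 * h) ^+ 2 * r^-1 / 2 by field; rewrite gt_eqF.
  by rewrite q0 in U; lra.
have cG : {within `]0, l[, continuous G}.
  move=> s; apply: cvgM; first exact: cvg_cst.
  by apply: cvgM; [exact: cvg_cst|exact: ca].
have dG s : 0 < s -> s < l -> is_derive s 1 G 1.
  move=> s0 sl.
  have cs : {for s, continuous G}.
    move: cG; rewrite continuous_open_subspace; last exact: interval_open.
    by apply; rewrite inE /= in_itv/= s0.
  have /cvgrPdist_lt/(_ r r0)/nbhs_ballP[d /= d0 dP] := cs.
  have m0 : 0 < Num.min d (Num.min s (l - s)) by rewrite !lt_min d0 s0 subr_gt0.
  apply: (@is_derive_quadratic _ G s 1 (2 / r) _ m0) => h.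
  rewrite normr_gt0 => h0; rewrite !lt_min => /and3P[hd hs hl].
  have {}hs : - s < h < s by rewrite -ltr_norml.
  have {}hl : - (l - s) < h < l - s by rewrite -ltr_norml.
  have := dP (s + h); rewrite /ball /= opprD addNKr normrN => /(_ hd) Gr.
  rewrite mulr1; have [hpos|hneg|h00] := ltgtP 0 h; last by rewrite h00 eqxx in h0.
    have := quad s (s + h) s0; rewrite [s + h - s](_ : _ = h); last by ring.
    by apply; [lra|lra|move: Gr; rewrite ltr_norml; lra].
  have := quad (s + h) s; rewrite [s - (s + h)](_ : _ = - h); last by ring.
  rewrite sqrrN => q.
  rewrite -normrN; have -> : - (G (s + h) - G s - h) = G s - G (s + h) - - h by ring.
  by apply: q; [lra|lra|lra|move: Gr; rewrite ltr_norml; lra].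
have Glin s t : 0 < s -> s < t -> t < l -> G t - G s = t - s.
  move=> s0 st tl; have [||u _ ->] := @MVT _ G (cst 1) s t st; last by rewrite mul1r.
    move=> x; rewrite in_itv/= => /andP[sx xt]; apply: dG; lra.
  apply: continuous_subspaceW cG => x /=; rewrite !in_itv/=; lra.
pose be := G (l / 2) - l / 2.
have Gbe t : 0 < t -> t < l -> G t = t + be.
  move=> t0 tl; rewrite /be.
  have := Glin t (l / 2) t0; have := Glin (l / 2) t; case: (ltgtP t (l / 2)) => [h|h|->].
  - by move=> _ /(_ isT); lra.
  - by move=> + _; move=> /(_ _ isT tl); lra.
  - by move=> _ _; ring.
pose A := B + e * (be / r).
have gA t : 0 < t -> t < l -> gamma t = c + r *: dir (A + e * (t / r)).
  move=> t0 tl; rewrite gE// aG Gbe//; congr (_ + _ *: dir _).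
  by rewrite /A; ring.
(* The formula extends to the two ends by continuity, and they coincide. *)
have ends x : (forall d, 0 < d -> exists t, [/\ 0 < t, t < l & `|t - x| < d]) ->
    0 <= x <= l -> gamma x = c + r *: dir (A + e * (x / r)).
  move=> xd xl; apply/eqP; rewrite -subr_eq0; apply/eqP; apply: enorm_eq0.
  apply/eqP; rewrite eq_le enorm_ge0 andbT; apply/ler_addgt0Pr => d d0.
  have d2 : 0 < d / 2 by rewrite divr_gt0.
  have [t [t0 tl tx]] := xd _ d2.
  rewrite add0r [d]splitr -(subrKA (gamma t)).
  apply: le_trans (enormD _ _) _; apply: lerD; apply: le_trans (ltW tx).
    have [xt|/ltW tx'] := leP x t.
      by rewrite enormC ger0_norm ?subr_ge0//; apply: lip => //; lra.
    by rewrite distrC ger0_norm ?subr_ge0//; apply: lip => //; lra.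
  rewrite gA// opprD addrACA subrr add0r -scalerBr enormZ gtr0_norm//.
  rewrite mulrC -ler_pdivlMr//; apply: le_trans (enorm_dirB_le _ _) _.
  rewrite opprD addrACA subrr add0r -mulrBr normrM ee mul1r -mulrBl normrM.
  by rewrite [`|r^-1|]gtr0_norm// invr_gt0.
have l2 : 0 < l / 2 by rewrite divr_gt0.
have g0 : gamma 0 = c + r *: dir (A + e * (0 / r)).
  apply: ends; last by rewrite lexx ltW.
  move=> d d0; exists (Num.min (d / 2) (l / 2)).
  have m0 : 0 < Num.min (d / 2) (l / 2) by rewrite lt_min l2 divr_gt0.
  have m1 : Num.min (d / 2) (l / 2) <= d / 2 by rewrite ge_min lexx.
  have m2 : Num.min (d / 2) (l / 2) <= l / 2 by rewrite ge_min lexx orbT.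
  by split; [|lra|rewrite subr0 gtr0_norm//; lra].
have gl : gamma l = c + r *: dir (A + e * (l / r)).
  apply: ends; last by rewrite lexx ltW.
  move=> d d0; exists (l - Num.min (d / 2) (l / 2)).
  have m0 : 0 < Num.min (d / 2) (l / 2) by rewrite lt_min l2 divr_gt0.
  have m1 : Num.min (d / 2) (l / 2) <= d / 2 by rewrite ge_min lexx.
  have m2 : Num.min (d / 2) (l / 2) <= l / 2 by rewrite ge_min lexx orbT.
  by split; [lra|lra|rewrite addrAC subrr add0r normrN gtr0_norm//; lra].
split; last by exists A, e.
rewrite leNgt; apply/negP => lpi.
have lr : 0 < l / r < pi *+ 2.
  by rewrite divr_gt0//= ltr_pdivrMr// mulr2n; lra.
have : cos (l / r) = 1.
  have : dir A = dir (A + e * (l / r)).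
    move: g0l; rewrite g0 gl mul0r mulr0 addr0 => /addrI /eqP.
    by rewrite -subr_eq0 -scalerBr scaler_eq0 gt_eqF//= subr_eq0 => /eqP.
  move=> dE; have <- : cos (A + e * (l / r) - A) = cos (l / r).
    rewrite addrAC subrr add0r; case: eE => ->; first by rewrite mul1r.
    by rewrite mulN1r cosN.
  by rewrite -dot_dir -dE -sqr_enorm enorm_dir expr1n.
by have := cos_lt1 lr => + c1; rewrite c1 ltxx.
Qed.

End param.
End circle_unique.

(** * The disk as maximizer *)

Section disk.
Context {R : realType}.
Variables (c : R * R) (r : R).
Hypothesis r0 : 0 < r.
Local Notation mu := (@lebesgue_measure R).
Implicit Types (C : set (R * R)) (p q : R * R).
Local Notation k := (r^-1 `^ 3^-1).

Let k0 : 0 < k. Proof. by rewrite powR_gt0// invr_gt0. Qed.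

Let square (h : R) : set (R * R) :=
  `[c.1 - h, c.1 + h] `*` `[c.2 - h, c.2 + h].

Lemma disk_sub_square : disk c r `<=` square r.
Proof.
move=> p pr; have := le_trans (normr_fst_le _) pr.
have := le_trans (normr_snd_le _) pr.
by rewrite /square /= !in_itv/= !ler_norml /=; lra.
Qed.

Lemma square_sub_disk : square (r / 2) `<=` disk c r.
Proof.
move=> p [] /=; rewrite !in_itv/= => h1 h2.
apply: le_trans (enorm_le_sum _) _; rewrite [r]splitr /=.
by apply: lerD; rewrite ler_norml; lra.
Qed.

Lemma compact_disk : compact (disk c r).
Proof.
apply: (subclosed_compact (@closed_disk R c r) _ disk_sub_square).
by apply: compact_setX; exact: segment_compact.
Qed.

Lemma convex_disk : convex_set (M := (R * R)%type) (disk c r).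
Proof.
move=> p q t; rewrite !inE => pr qr; rewrite /disk /=.
have -> : (conv t p q : R * R) - c =
    t%:num *: (p - c) + (1 - t%:num) *: (q - c).
  rewrite -[conv t p q]/(t%:num *: (p : R * R) + (1 - t%:num) *: (q : R * R)).
  move: t%:num => x; case: (p) (q) c => [p1 p2] [q1 q2] [c1 c2].
  by congr pair; rewrite /= /GRing.scale /=; ring.
apply: le_trans (enormD _ _) _; rewrite !enormZ.
have t0 : 0 <= t%:num by []; have t1 : t%:num <= 1 by [].
rewrite ger0_norm// ger0_norm ?subr_ge0//.
rewrite /disk /= in pr qr; nra.
Qed.

Lemma affine_perimeter_ge0 C : (0 <= affine_perimeter C)%E.
Proof.
rewrite /affine_perimeter; case: xgetP => [L _ [l [gamma [_ ->]]]|//].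
by apply: integral_ge0 => s _; rewrite lee_fin powR_ge0.
Qed.

Lemma affine_perimeter_le C : compact_convex_subset (disk c r) C ->
  (affine_perimeter C <= (2 * pi * r * k)%:E)%E.
Proof.
move=> [kC cC Cr]; have pi0 := pi_gt0 R.
rewrite /affine_perimeter; case: xgetP => [L _ [l [gamma [gC ->]]]|_]; last first.
  by rewrite lee_fin !mulr_ge0// ltW.
apply: le_trans (param_affine_perimeter_le r0 kC cC Cr gC) _; rewrite lee_fin.
have := perimeter_le kC cC Cr gC => ll.
have -> : 2 * pi * r * k = k / 3 * (2 * pi * r + 2 * (2 * pi * r)) by field.
by rewrite ler_pM2l ?divr_gt0//; lra.
Qed.

Lemma affine_perimeter_lt C p : compact_convex_subset (disk c r) C ->
  disk c r p -> ~ C p -> (affine_perimeter C < (2 * pi * r * k)%:E)%E.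
Proof.
move=> [kC cC Cr] pr Cp; have pi0 := pi_gt0 R.
rewrite /affine_perimeter; case: xgetP => [L _ [l [gamma [gC ->]]]|_]; last first.
  by rewrite lte_fin !mulr_gt0.
apply: le_lt_trans (param_affine_perimeter_le r0 kC cC Cr gC) _; rewrite lte_fin.
have := perimeter_lt r0 kC cC Cr gC pr Cp => ll.
have -> : 2 * pi * r * k = k / 3 * (2 * pi * r + 2 * (2 * pi * r)) by field.
by rewrite ltr_pM2l ?divr_gt0//; lra.
Qed.

(** All parametrizations of the circle have the same curvature and reach the
    general upper bound. *)
Lemma affine_perimeter_disk : affine_perimeter (disk c r) = (2 * pi * r * k)%:E.
Proof.
apply/eqP; rewrite eq_le affine_perimeter_le/=; last first.
  by split; [exact: compact_disk|exact: convex_disk|].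
rewrite /affine_perimeter; case: xgetP => [L _ [l [gamma [gC ->]]]|no]; last first.
  exfalso; apply: (no (param_affine_perimeter (2 * pi * r) (rotation c r))).
  exists (2 * pi * r), (rotation c r); split => //.
  exact: arc_length_param_rotation.
have [lge [A [e [e1 gE]]]] := circle_param_rotation r0 gC.
have l0 : 0 < l by case: gC.
apply: (@le_trans _ _ (k%:E * mu `]0%R, l[)%E).
  rewrite lebesgue_measure_itv/= lte_fin l0 oppr0 adde0 -EFinM lee_fin.
  by rewrite mulrC ler_wpM2l// ltW.
apply: cst_mul_le_integral => //.
- by move=> s /=; rewrite !in_itv/= => /andP[/ltW-> /ltW->].
- exact: ltW.
- by move=> s _; rewrite lee_fin powR_ge0.
move=> s; rewrite /= in_itv/= => /andP[s0 sl].
by rewrite (curvature_rotation r0 e1 gE).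
Qed.

Lemma measurable_disk : measurable (disk c r).
Proof.
have -> : disk c r = [set: R * R] `&`
    ((fun p => (p.1 - c.1) ^+ 2 + (p.2 - c.2) ^+ 2) @^-1` `]-oo, r ^+ 2]).
  rewrite setTI; apply/seteqP; split => p /=; rewrite in_itv/= => h.
    rewrite !expr2 -[_ + _]/(dot (p - c) (p - c)) -sqr_enorm.
    by apply: lerXn2r => //; rewrite nnegrE ?enorm_ge0// ltW.
  by apply: enorm_le; [exact: ltW|rewrite /dot -!expr2].
have m : measurable_fun [set: R * R]
    (fun p : R * R => (p.1 - c.1) ^+ 2 + (p.2 - c.2) ^+ 2).
  apply: measurable_funD; apply: measurable_funX; apply: measurable_funB => //.
exact: m.
Qed.

Lemma area_square h : 0 < h ->
  area (square h) = ((2 * h) * (2 * h))%:E /\ measurable (square h).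
Proof.
move=> h0; split; last by apply: measurableX.
have side x : mu `[x - h, x + h] = (2 * h)%:E.
  rewrite lebesgue_measure_itv/= lte_fin; have -> : x - h < x + h by lra.
  by rewrite -EFinB; congr EFin; ring.
rewrite /area /square product_measure1E// EFinM.
by move: (side c.1) (side c.2) => /= -> ->.
Qed.

Lemma area_disk : exists2 a : R, 0 < a & area (disk c r) = a%:E.
Proof.
have [e1 m1] := area_square r0.
have r2 : 0 < r / 2 by rewrite divr_gt0.
have [e2 m2] := area_square r2.
have le1 : (area (disk c r) <= ((2 * r) * (2 * r))%:E)%E.
  rewrite -e1; apply: le_measure; rewrite ?inE//; first exact: measurable_disk.
  exact: disk_sub_square.
have le2 : (((2 * (r / 2)) * (2 * (r / 2)))%:E <= area (disk c r))%E.
  rewrite -e2; apply: le_measure; rewrite ?inE//; first exact: measurable_disk.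
  exact: square_sub_disk.
move: le1 le2; case: (area _) => // a _; rewrite lee_fin => h.
by exists a => //; apply: lt_le_trans h; rewrite !mulr_gt0.
Qed.

(** The area is the integral of the lengths of the sections, and the sections of
    a compact set are closed. *)
Lemma area_le C : compact C -> C `<=` disk c r -> (area C <= area (disk c r))%E.
Proof.
move=> kC Cr; rewrite /area /product_measure1.
have mD := measurable_fun_xsection mu measurable_disk.
apply: (@le_integral_off_negligible _ _ _ mu setT set0) => //.
move=> x _ _ /=; apply: le_measure; rewrite ?inE.
- have -> : xsection C x = (fun y => (x, y)) @^-1` C.
    by apply/seteqP; split => y; rewrite /xsection /= inE.
  apply: closed_measurable.
  apply: (@preimage_closed R (R * R)%type (fun y => (x, y)) C).
    move=> y _; apply: (@cvg_pair _ _ _ (nbhs y) (nbhs x) (nbhs y)).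
      exact: cvg_cst.
    exact: cvg_id.
  by apply: compact_closed => //; exact: norm_hausdorff.
- exact: measurable_xsection measurable_disk.
- by move=> y; rewrite /xsection /= !inE; exact: Cr.
Qed.

End disk.

Theorem corollary1p17 (R : realType) (c : R * R) (r : R) (hr : 0 < r)
    (lambda : R) (hlambda : 0 <= lambda) :
  is_maximizer (Phi lambda) (compact_convex_subset (disk c r)) (disk c r) /\
  forall M : set (R * R),
    is_maximizer (Phi lambda) (compact_convex_subset (disk c r)) M ->
    M = disk c r.
Proof.
have [a a0 aE] := area_disk c hr.
pose X := 2 * pi * r * r^-1 `^ 3^-1.
have pi0 := pi_gt0 R.
have X0 : 0 < X by rewrite !mulr_gt0// powR_gt0// invr_gt0.
have PhiD : Phi lambda (disk c r) = (X ^+ 3 * a `^ lambda)%:E.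
  by rewrite /Phi affine_perimeter_disk// aE poweR_EFin -EFin_expe -EFinM.
have FD : compact_convex_subset (disk c r) (disk c r).
  by split; [exact: compact_disk|exact: convex_disk|].
have PhiE C : compact_convex_subset (disk c r) C -> exists x y,
    [/\ affine_perimeter C = x%:E, 0 <= x, x <= X, y `^ lambda <= a `^ lambda &
      Phi lambda C = (x ^+ 3 * y `^ lambda)%:E].
  move=> FC; have [kC _ Cr] := FC.
  have := affine_perimeter_ge0 C; have := affine_perimeter_le hr FC.
  have : (0 <= area C)%E by exact: measure_ge0.
  have := area_le hr kC Cr; rewrite aE /Phi.
  case: (area C) => // y; rewrite !lee_fin => ya y0.
  case: (affine_perimeter C) => // x; rewrite !lee_fin => xX x0.
  by exists x, y; split => //; apply: ge0_ler_powR; rewrite ?nnegrE// ltW.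
have al0 : 0 < a `^ lambda by rewrite powR_gt0.
split.
  split => // C FC; have [x [y [_ x0 xX ya ->]]] := PhiE C FC.
  rewrite PhiD lee_fin; apply: ler_pM => //; rewrite ?exprn_ge0 ?powR_ge0//.
  by apply: lerXn2r; rewrite ?nnegrE// ltW.
move=> M [FM Mmax]; have [_ _ Mr] := FM.
apply/seteqP; split => // p pr; apply: contrapT => Mp.
have := Mmax _ FD; have [x [y [xE x0 xX ya ->]]] := PhiE M FM.
have := affine_perimeter_lt hr FM pr Mp; rewrite xE lte_fin => xltX.
rewrite PhiD lee_fin leNgt => /negP; apply.
apply: (@le_lt_trans _ _ (x ^+ 3 * a `^ lambda)).
  by rewrite ler_wpM2l ?exprn_ge0.
by rewrite ltr_pM2r// ltrXn2r.
Qed.
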